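(* Let $d\ge1$, $\eta>(d-1)/2$, $\omega_{d,\eta}>0$ and $\sigma>0$. a) The distribution $A\Gamma_d(\eta,\sigma\mathrm{I}_d)$ is invariant under orthogonal conjugations. b) If $M\sim A\Gamma_d(\eta,\sigma\mathrm{I}_d)$, then $\mathrm{tr}(M)$ follows a one-dimensional Gamma distribution $\Gamma(\omega_{d,\eta},1/\sigma)$, i.e. with shape $\omega_{d,\eta}$ and rate $1/\sigma$ (scale $\sigma$).
   Context: $\mathbb{S}_d^+$ and $\overline{\mathbb{S}}_d^+$ are the open cone of positive definite and the closed cone of nonnegative definite symmetric real $d\times d$ matrices; $|X|$ is the determinant, $\mathrm{I}_d$ the identity matrix. The trace norm is $\|X\|=\mathrm{tr}((X^\top X)^{1/2})$, and $\mathbf{S}^+_{\|\cdot\|}=\{U\in\overline{\mathbb{S}}_d^+:\mathrm{tr}(U)=1\}$. $\mathrm{d}X$ is Lebesgue measure on symmetric matrices identified with $\mathbb{R}^{d(d+1)/2}$, and $\mathrm{d}U$ is the measure on $\mathbf{S}^+_{\|\cdot\|}$ determined by $\mathrm{d}X=r^{d(d+1)/2-1}\,\mathrm{d}r\,\mathrm{d}U$ under $X=rU$, $r=\mathrm{tr}(X)$, for $X\in\mathbb{S}_d^+$. $\Gamma_d(\eta)=\int_{\mathbb{S}_d^+}e^{-\mathrm{tr}(X)}|X|^{\eta-(d+1)/2}\mathrm{d}X$. For a finite measure $\alpha$ on $\mathbf{S}^+_{\|\cdot\|}$ and measurable $\beta:\mathbf{S}^+_{\|\cdot\|}\to[0,\infty)$,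 the matrix Gamma distribution with parameters $\alpha,\beta$ (trace norm) is the infinitely divisible distribution on $\overline{\mathbb{S}}_d^+$ with Laplace transform $\exp\{-\int_{\mathbf{S}^+_{\|\cdot\|}}\int_0^\infty(1-e^{-r\,\mathrm{tr}(\Theta U)})\frac{e^{-\beta(U)r}}{r}\,\mathrm{d}r\,\alpha(\mathrm{d}U)\}$, $\Theta\in\overline{\mathbb{S}}_d^+$. For $\eta>(d-1)/2$, $\Sigma\in\mathbb{S}_d^+$ and a given constant $\omega_{d,\eta}>0$, $A\Gamma_d(\eta,\Sigma)$ is the matrix Gamma distribution with parameters $\beta_\Sigma(U)=\mathrm{tr}(\Sigma^{-1}U)$ and $\alpha_{\eta,\Sigma}(\mathrm{d}U)=\frac{1}{|\Sigma|^\eta\,\mathrm{tr}(\Sigma^{-1}U)^{\eta d}}\,\alpha_\eta(\mathrm{d}U)$, where $\alpha_\eta(\mathrm{d}U)=c_{d,\eta}|U|^{\eta-(d+1)/2}\mathrm{d}U$ and $c_{d,\eta}=\omega_{d,\eta}\Gamma(\eta d)/\Gamma_d(\eta)$. The law of a symmetric random matrix $M$ is invariant under orthogonal conjugations if $OMO^\top$ has the same law as $M$ for every nonrandom orthogonal $d\times d$ matrix $O$. The one-dimensional Gamma distribution $\Gamma(a,b)$ has shape $a$ and rate $b$, i.e. Laplace transform $(1+\theta/b)^{-a}$. *)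

(* Defs.v *)
From HB Require Import structures.
From mathcomp Require Import all_boot all_order all_algebra.
From mathcomp Require Import all_classical all_reals all_analysis.
From mathcomp Require Import measurable_realfun.

Set Implicit Arguments.
Unset Strict Implicit.
Unset Printing Implicit Defensive.

Import Order.TTheory GRing.Theory Num.Theory.
Import numFieldNormedType.Exports.

Local Open Scope classical_set_scope.
Local Open Scope ring_scope.

Definition measure_mx_display : measure_display -> measure_display.
Proof. exact. Qed.

(* The sigma-algebra generated by the entries, as the library does for tuples;
   over the reals it is the Borel sigma-algebra. *)
Section measurable_matrix.
Context {disp : measure_display} {T : sigmaRingType disp} (m n : nat).

Let coors : 'I_(m * n) -> 'M[T]_(m, n) -> T := fun k X => mxvec X ord0 k.

Let mx_set0 : g_sigma_preimage coors set0.
Proof. exact: sigma_algebra0. Qed.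

Let mx_setC A : g_sigma_preimage coors A -> g_sigma_preimage coors (~` A).
Proof. exact: sigma_algebraC. Qed.

Let mx_bigcup (F : (set 'M[T]_(m, n))^nat) :
  (forall i, g_sigma_preimage coors (F i)) ->
  g_sigma_preimage coors (\bigcup_i (F i)).
Proof. exact: sigma_algebra_bigcup. Qed.

HB.instance Definition _ := @isMeasurable.Build (measure_mx_display disp)
  'M[T]_(m, n) (g_sigma_preimage coors) mx_set0 mx_setC mx_bigcup.

End measurable_matrix.

Lemma measurable_entry {disp : measure_display} {T : sigmaRingType disp}
    (m n : nat) (i : 'I_m) (j : 'I_n) :
  measurable_fun [set: 'M[T]_(m, n)] (fun X => X i j).
Proof.
move=> _ Y mY; rewrite setTI; apply: sub_sigma_algebra => /=.
rewrite -bigcup_seq/=; exists (mxvec_index i j) => /=.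
  by rewrite mem_index_enum.
by exists Y => //; rewrite setTI; apply/seteqP; split => X /=; rewrite mxvecE.
Qed.

Lemma measurable_fun_mxP {disp disp' : measure_display}
    {T1 : measurableType disp} {T2 : measurableType disp'} (m n : nat)
    (f : T1 -> 'M[T2]_(m, n)) :
  measurable_fun [set: T1] f <->
  forall i j, measurable_fun [set: T1] (fun x => f x i j).
Proof.
split=> [mf i j|mf].
  exact: (measurableT_comp (@measurable_entry _ T2 m n i j) mf).
move=> _ Y mY; rewrite setTI.
have sub : g_sigma_preimage
    (fun (k : 'I_(m * n)) (X : 'M[T2]_(m, n)) => mxvec X ord0 k)
    `<=` [set B | measurable (f @^-1` B)].
  apply: smallest_sub.
    split=> [|A /= mA|F /= mF]; first by rewrite /= preimage_set0.
      by rewrite setTD preimage_setC; exact: measurableC.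
    by rewrite preimage_bigcup; exact: bigcupT_measurable.
  rewrite -bigcup_seq; apply: bigcup_sub => k _ A [B mB <-] /=.
  case/mxvec_indexP: k => i j.
  have := mf i j measurableT B mB; rewrite !setTI.
  by congr measurable; apply/seteqP; split => x /=; rewrite mxvecE.
exact: sub.
Qed.

Lemma measurable_mxtrace {R : realType} (d : nat) :
  measurable_fun [set: 'M[R]_d] (fun X => \tr X).
Proof. by apply: measurable_sum => i; exact: measurable_entry. Qed.

Lemma measurable_det {R : realType} (d : nat) :
  measurable_fun [set: 'M[R]_d] (fun X => \det X).
Proof.
apply: measurable_sum => s; apply: measurable_funM => //.
by apply: measurable_prod => i _; exact: measurable_entry.
Qed.

Lemma measurable_mulmxl {R : realType} (d : nat) (S : 'M[R]_d) :
  measurable_fun [set: 'M[R]_d] (fun X => S *m X).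
Proof.
apply/measurable_fun_mxP => i j; under eq_fun do rewrite mxE.
apply: measurable_sum => k; apply: measurable_funM => //.
exact: measurable_entry.
Qed.

Section mdensity.
Context {disp : measure_display} {T : measurableType disp} {R : realType}.

Definition mdensity (mu : {measure set T -> \bar R}) (f : T -> R)
    (mf : measurable_fun [set: T] f) (f0 : forall x, 0 <= f x) : set T -> \bar R :=
  fun A => (\int[mu]_(x in A) (f x)%:E)%E.

Context (mu : {measure set T -> \bar R}) (f : T -> R).
Context (mf : measurable_fun [set: T] f) (f0 : forall x, 0 <= f x).

Let mdensity0 : mdensity mu mf f0 set0 = 0%E.
Proof. by rewrite /mdensity integral_set0. Qed.

Let mdensity_ge0 A : (0 <= mdensity mu mf f0 A)%E.
Proof. by apply: integral_ge0 => x _; rewrite lee_fin. Qed.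

Let mdensity_sigma_additive : semi_sigma_additive (mdensity mu mf f0).
Proof.
apply: semi_sigma_additive_nng_induced; first exact/measurable_EFinP.
by move=> x; rewrite lee_fin.
Qed.

HB.instance Definition _ := isMeasure.Build _ _ _ (mdensity mu mf f0)
  mdensity0 mdensity_ge0 mdensity_sigma_additive.

End mdensity.

Section lebesgue_tuple.
Context {R : realType}.

(* Lebesgue measure on R^n *)
Fixpoint lebesgue_tuple (n : nat) : set (n.-tuple R) -> \bar R :=
  match n with
  | 0 => \d_ [tuple]
  | n'.+1 => pushforward (@lebesgue_measure R \x @lebesgue_tuple n')%E
      (fun x : R * n'.-tuple R => [tuple of x.1 :: x.2])
  end.

Arguments lebesgue_tuple n _ : clear implicits.

Let measurable_tcons (n : nat) :
  measurable_fun setT (fun x : R * n.-tuple R => [tuple of x.1 :: x.2]).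
Proof. exact: measurable_cons. Qed.

Let tuncons (n : nat) (t : n.+1.-tuple R) : R * n.-tuple R :=
  (thead t, [tuple of behead t]).

Let measurable_tuncons (n : nat) : measurable_fun setT (@tuncons n).
Proof.
apply/measurable_fun_pairP; split; first exact: measurable_tnth.
exact: measurable_behead.
Qed.

Lemma lebesgue_tuple_measureP (n : nat) :
  exists m : {sigma_finite_measure set (n.-tuple R) -> \bar R},
    lebesgue_tuple n = m :> (set _ -> \bar R).
Proof.
elim: n => [|n [m IH]]; first by exists \d_ [tuple].
pose tc := fun x : R * n.-tuple R => [tuple of x.1 :: x.2].
have utK x : tuncons (tc x) = x.
  by case: x => x t; congr pair; apply/val_inj.
pose lm : {measure set _ -> \bar R} := (@lebesgue_measure R \x m)%E.
pose mf : measurable_fun setT tc := @measurable_tcons n.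
pose mc := measure_function_pushforward__canonical__measure_function_Measure
  lm mf.
have sf : sigma_finite setT mc.
  have /sigma_finiteP[F [TF ndF Foo]] := sigma_finiteT (@lebesgue_measure R).
  have /sigma_finiteP[G [TG ndG Goo]] := sigma_finiteT m.
  have mFG i : measurable (F i `*` G i).
    by have [? _] := Foo i; have [? _] := Goo i; exact: measurableX.
  exists (fun i => @tuncons n @^-1` (F i `*` G i)).
    apply/seteqP; split => // t _.
    have : setT (thead t) by [].
    rewrite TF => -[j _ Fj].
    have : setT [tuple of behead t] by [].
    rewrite TG => -[k _ Gk].
    exists (maxn j k) => //=; split => /=.
    - by move: Fj; exact/subsetPset/ndF/leq_maxl.
    - by move: Gk; exact/subsetPset/ndG/leq_maxr.
  move=> i; split.
    have := @measurable_tuncons n measurableT _ (mFG i).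
    by rewrite setTI.
  have -> : mc (@tuncons n @^-1` (F i `*` G i)) = lm (F i `*` G i).
    rewrite /mc/= /pushforward -comp_preimage.
    by rewrite (_ : _ \o _ = id)//; apply/funext => x; exact: utK.
  have [mFi Fioo] := Foo i; have [mGi Gioo] := Goo i.
  by rewrite /lm/= product_measure1E// lte_mul_pinfty// ge0_fin_numE.
pose H := Measure_isSigmaFinite.Build _ _ _ (Measure.sort mc) sf.
pose M : {sigma_finite_measure set (n.+1.-tuple R) -> \bar R} :=
  HB.pack (Measure.sort mc) (Measure.class mc) H.
by exists M => /=; rewrite IH.
Qed.

Section lebesgue_tuple_measure.
Context (n : nat).

Let lebesgue_tuple0 : lebesgue_tuple n set0 = 0%E.
Proof. by have [m ->] := lebesgue_tuple_measureP n. Qed.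

Let lebesgue_tuple_ge0 A : (0 <= lebesgue_tuple n A)%E.
Proof. by have [m ->] := lebesgue_tuple_measureP n. Qed.

Let lebesgue_tuple_sigma_additive : semi_sigma_additive (lebesgue_tuple n).
Proof.
have [m ->] := lebesgue_tuple_measureP n.
exact: measure_semi_sigma_additive.
Qed.

HB.instance Definition _ := isMeasure.Build _ _ _ (lebesgue_tuple n)
  lebesgue_tuple0 lebesgue_tuple_ge0 lebesgue_tuple_sigma_additive.

Let lebesgue_tuple_sigma_finite : sigma_finite setT (lebesgue_tuple n).
Proof.
by have [m ->] := lebesgue_tuple_measureP n; exact: sigma_finiteT.
Qed.

HB.instance Definition _ := Measure_isSigmaFinite.Build _ _ _
  (lebesgue_tuple n) lebesgue_tuple_sigma_finite.

End lebesgue_tuple_measure.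

End lebesgue_tuple.
Arguments lebesgue_tuple {R} n _.

Section symmetric_matrices.
Context {R : realType} (d : nat).

Definition nonneg_definite : set 'M[R]_d :=
  [set X | X^T = X /\ forall v : 'rV[R]_d, 0 <= (v *m X *m v^T) 0 0].

Definition pos_definite : set 'M[R]_d :=
  [set X | X^T = X /\ forall v : 'rV[R]_d, v != 0 -> 0 < (v *m X *m v^T) 0 0].

(* on nonnegative definite matrices the trace norm is the trace *)
Definition trace_sphere : set 'M[R]_d := nonneg_definite `&` [set U | \tr U = 1].

(* The entries (i, j), i <= j, of the upper triangle are read column by column
   from the d(d+1)/2 coordinates: (i, j) is coordinate number j(j+1)/2 + i. *)
Definition sym_mx (t : (d * d.+1)./2.-tuple R) : 'M[R]_d :=
  \matrix_(i, j) t`_((maxn i j * (maxn i j).+1)./2 + minn i j).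

Lemma measurable_sym_mx : measurable_fun setT sym_mx.
Proof.
apply/measurable_fun_mxP => i j; under eq_fun do rewrite mxE.
set k := (_ + _)%N.
have [kn|nk] := ltnP k ((d * d.+1)./2).
  under eq_fun do rewrite -(tnth_nth 0 _ (Ordinal kn)).
  exact: measurable_tnth.
under eq_fun do rewrite nth_default ?size_tuple//.
exact: measurable_cst.
Qed.

HB.instance Definition _ :=
  isMeasurableFun.Build _ _ _ _ sym_mx measurable_sym_mx.

(* dX, as a measure on all matrices carried by the symmetric ones *)
Definition lebesgue_sym : set 'M[R]_d -> \bar R :=
  pushforward (@lebesgue_tuple R (d * d.+1)./2) sym_mx.

Let lebesgue_sym0 : lebesgue_sym set0 = 0%E.
Proof. by rewrite /lebesgue_sym /pushforward preimage_set0 measure0. Qed.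

Let lebesgue_sym_ge0 A : (0 <= lebesgue_sym A)%E.
Proof. exact: measure_ge0. Qed.

Let lebesgue_sym_sigma_additive : semi_sigma_additive lebesgue_sym.
Proof.
exact: (@measure_semi_sigma_additive _ _ _
  (measure_function_pushforward__canonical__measure_function_Measure
    (lebesgue_tuple (d * d.+1)./2) measurable_sym_mx)).
Qed.

HB.instance Definition _ := isMeasure.Build _ _ _ lebesgue_sym
  lebesgue_sym0 lebesgue_sym_ge0 lebesgue_sym_sigma_additive.

(* [dU] is the measure on the trace sphere with dX = r^(d(d+1)/2-1) dr dU.
   As the relation concerns positive definite X only, it says nothing about
   singular matrices; these are not charged. *)
Definition is_spherical_measure (dU : {measure set 'M[R]_d -> \bar R}) : Prop :=
  dU (~` (trace_sphere `&` pos_definite)) = 0%E /\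
  forall f : 'M[R]_d -> \bar R,
    measurable_fun setT f -> (forall X, 0 <= f X)%E ->
    (\int[lebesgue_sym]_(X in pos_definite) f X =
     \int[dU]_(U in trace_sphere) \int[lebesgue_measure]_(r in `]0%R, +oo[)
       (f (r *: U) * (r ^+ ((d * d.+1)./2).-1)%:E))%E.

End symmetric_matrices.

Arguments nonneg_definite {R} d _.
Arguments pos_definite {R} d _.
Arguments trace_sphere {R} d _.
Arguments lebesgue_sym {R} d _.

Section gamma_functions.
Context {R : realType}.

(* [fine] maps a divergent integral to 0; it plays no role for 0 < a and
   (d - 1) / 2 < eta, where the integrals converge. *)

Definition gamma_fun (a : R) : R :=
  fine (\int[lebesgue_measure]_(x in `]0%R, +oo[) (x `^ (a - 1) * expR (- x))%:E)%E.

Definition mgamma_fun (d : nat) (eta : R) : R :=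
  fine (\int[lebesgue_sym d]_(X in pos_definite d)
          (expR (- \tr X) * \det X `^ (eta - d.+1%:R / 2))%:E)%E.

Definition gamma_pdf (a b x : R) : R :=
  if 0 < x then b `^ a / gamma_fun a * x `^ (a - 1) * expR (- (b * x)) else 0.

(* one-dimensional Gamma distribution with shape [a] and rate [b] *)
Definition gamma_prob (a b : R) : set R -> \bar R :=
  fun V => (\int[lebesgue_measure]_(x in V) (gamma_pdf a b x)%:E)%E.

Lemma gamma_fun_ge0 (a : R) : 0 <= gamma_fun a.
Proof.
by apply: fine_ge0; apply: integral_ge0 => x _;
  rewrite lee_fin mulr_ge0 ?powR_ge0 ?expR_ge0.
Qed.

Lemma mgamma_fun_ge0 (d : nat) (eta : R) : 0 <= mgamma_fun d eta.
Proof.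
by apply: fine_ge0; apply: integral_ge0 => X _;
  rewrite lee_fin mulr_ge0 ?powR_ge0 ?expR_ge0.
Qed.

End gamma_functions.

Section infinite_divisibility.
Context {R : realType} {d : nat}.
Implicit Types mu nu : set 'M[R]_d -> \bar R.

Definition convolution mu nu : set 'M[R]_d -> \bar R :=
  pushforward (mu \x nu)%E (fun p : 'M[R]_d * 'M[R]_d => p.1 + p.2).

Fixpoint convolution_power mu (n : nat) : set 'M[R]_d -> \bar R :=
  match n with
  | 0 => \d_ (0 : 'M[R]_d)
  | n'.+1 => convolution mu (convolution_power mu n')
  end.

Definition infinitely_divisible (mu : probability 'M[R]_d R) : Prop :=
  forall n : nat, (0 < n)%N -> exists nu : probability 'M[R]_d R,
    forall A, measurable A -> mu A = convolution_power nu n A.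

End infinite_divisibility.

Section matrix_gamma.
Context {R : realType} (d : nat).

(* The exponent is an integral in [\bar R], so that the formula makes sense
   whether or not [alpha] is finite; finiteness is not assumed. *)
Definition is_matrix_gamma (alpha : {measure set 'M[R]_d -> \bar R})
    (beta : 'M[R]_d -> R) (mu : probability 'M[R]_d R) : Prop :=
  [/\ infinitely_divisible mu,
      mu (nonneg_definite d) = 1%E &
      forall Theta : 'M[R]_d, nonneg_definite d Theta ->
        (\int[mu]_X (expR (- \tr (Theta *m X)))%:E =
         expeR (- \int[alpha]_(U in trace_sphere d)
                    \int[lebesgue_measure]_(r in `]0%R, +oo[)
                      ((1 - expR (- (r * \tr (Theta *m U))))
                       * (expR (- (beta U * r)) / r))%:E))%E].

Context (dU : {measure set 'M[R]_d -> \bar R}) (eta : R) (omega : {posnum R}).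

Definition c_gamma : R :=
  omega%:num * gamma_fun (eta * d%:R) / mgamma_fun d eta.

Definition density_eta (U : 'M[R]_d) : R :=
  c_gamma * \det U `^ (eta - d.+1%:R / 2).

Let measurable_density_eta : measurable_fun setT density_eta.
Proof.
apply: measurable_funM => //.
exact: (measurableT_comp (measurable_powR (eta - d.+1%:R / 2)) (@measurable_det R d)).
Qed.

Let density_eta_ge0 U : 0 <= density_eta U.
Proof.
by rewrite mulr_ge0 ?powR_ge0// mulr_ge0 ?invr_ge0 ?mgamma_fun_ge0// mulr_ge0
  ?gamma_fun_ge0.
Qed.

Definition alpha_eta : {measure set 'M[R]_d -> \bar R} :=
  mdensity dU measurable_density_eta density_eta_ge0.

Context (Sigma : 'M[R]_d).

Definition beta_Sigma (U : 'M[R]_d) : R := \tr (invmx Sigma *m U).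

Definition density_Sigma (U : 'M[R]_d) : R :=
  (\det Sigma `^ eta * beta_Sigma U `^ (eta * d%:R))^-1.

Let measurable_density_Sigma : measurable_fun setT density_Sigma.
Proof.
rewrite (_ : density_Sigma = fun U =>
    \det Sigma `^ (- eta) * beta_Sigma U `^ (- (eta * d%:R))); last first.
  by apply/funext => U; rewrite /density_Sigma invfM !powRN.
apply: measurable_funM => //.
apply: (measurableT_comp (measurable_powR _)).
exact: (measurableT_comp (@measurable_mxtrace R d) (@measurable_mulmxl R d (invmx Sigma))).
Qed.

Let density_Sigma_ge0 U : 0 <= density_Sigma U.
Proof. by rewrite invr_ge0 mulr_ge0 ?powR_ge0. Qed.

Definition alpha_Sigma : {measure set 'M[R]_d -> \bar R} :=
  mdensity alpha_eta measurable_density_Sigma density_Sigma_ge0.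

Definition is_AGamma (mu : probability 'M[R]_d R) : Prop :=
  is_matrix_gamma alpha_Sigma beta_Sigma mu.

End matrix_gamma.

Definition orthogonally_invariant {R : realType} (d : nat)
    (mu : probability 'M[R]_d R) : Prop :=
  forall O : 'M[R]_d, O *m O^T = 1%:M ->
  forall A, measurable A ->
    pushforward mu (fun X : 'M[R]_d => O *m X *m O^T) A = mu A.

(* Main.v *)
(* On the trace sphere the density of alpha_Sigma with respect to alpha_eta is
   1 and beta_Sigma is 1/sigma when Sigma = sigma I, so by Frullani's integral
   the Laplace exponent at Theta is the integral of c |U|^p ln(1 + sigma
   tr(Theta U)) dU, with p = eta - (d+1)/2.  Polar decomposition turns it into
   omega / Gamma_d(eta) times the integral over positive definite X of
   e^(-tr X) |X|^p ln(1 + sigma tr(Theta X) / tr X).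

   a) Lebesgue measure on symmetric matrices is invariant under orthogonal
   conjugation: by uniqueness of the Haar measure it is preserved up to a
   factor, and the factor is 1 because e^(-tr X) |X|^p is invariant with an
   integral in ]0, +oo[ (computed by induction on d with Schur complements).
   Hence the exponent is the same at Theta and O^T Theta O, and the Laplace
   transform on the cone determines the law.

   b) At Theta = t I the logarithm is constant and the exponent equals
   omega ln(1 + sigma t), that of the one-dimensional Gamma law. *)

Require Import Defs.
From HB Require Import structures.
From mathcomp Require Import all_boot all_order all_algebra.
From mathcomp Require Import all_classical all_reals all_analysis.
From mathcomp Require Import measurable_realfun ring lra.

Set Implicit Arguments.
Unset Strict Implicit.
Unset Printing Implicit Defensive.

Import Order.TTheory GRing.Theory Num.Theory.
Import numFieldNormedType.Exports.

Local Open Scope classical_set_scope.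
Local Open Scope ring_scope.

(** * Integrals on the line *)

(** Conjugation by O is not an orthogonal map in the upper-triangle coordinates, where an
    off-diagonal entry counts once although it occurs twice in the matrix, and its Jacobian is
    awkward to expand. The Haar argument avoids the Jacobian: it needs only translation invariance,
    Tonelli's theorem and one invariant test function whose integral can be cancelled. Integrals of
    nonnegative functions are kept in the extended reals throughout, so Tonelli applies before
    anything is known to be finite. Finiteness matters only where a term is subtracted or a factor
    cancelled. Uniqueness of the Laplace transform is proved by elementary means. On the line, the
    indicator of a half-line is a bounded limit of combinations of exponentials with nonnegative
    rates. Several nonnegative variables are handled one at a time, the exponentials of the others
    serving as a density. The cone reduces to this case through nonnegative linear coordinates that
    determine a symmetric matrix. *)

Lemma measurable_invr {R : realType} : measurable_fun [set: R] (@GRing.inv R).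
Proof.
(* The power with exponent -1 is the inverse only for nonnegative arguments, hence the detour
   through x^2; at 0 both sides are 0. *)
rewrite (_ : GRing.inv = fun x : R => x * (x ^+ 2) `^ (-1)).
  apply: measurable_funM => //.
  apply: (measurableT_comp (measurable_powR (-1))).
  exact: measurable_funX.
apply/funext => x; rewrite powR_inv1 ?sqr_ge0//.
have [->|x0] := eqVneq x 0; first by rewrite invr0 mul0r.
by field.
Qed.

Ltac mstep :=
  match goal with
  | |- measurable_fun _ (fun x => x) => exact: measurable_id
  | |- measurable_fun _ (fun _ => ?c) => exact: measurable_cst
  | |- measurable_fun ?D (fun x => EFin (@?f x)) => apply/(measurable_EFinP D f)
  | |- measurable_fun ?D (fun x => GRing.mul (@?f x) (@?g x)) =>
      apply: (@measurable_funM _ _ _ D f g)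
  | |- measurable_fun ?D (fun x => Algebra.add (@?f x) (@?g x)) =>
      apply: (@measurable_funD _ _ _ D f g)
  | |- measurable_fun ?D (fun x => Algebra.opp (@?f x)) =>
      apply: (@measurable_funN _ _ _ D f)
  | |- measurable_fun ?D (fun x => GRing.exp (@?f x) _) =>
      apply: (@measurable_funX _ _ _ D f)
  | |- measurable_fun ?D (fun x => expR (@?f x)) =>
      apply: (@measurableT_comp _ _ _ _ _ _ _ D f (@measurable_expR _))
  | |- measurable_fun ?D (fun x => ln (@?f x)) =>
      apply: (@measurableT_comp _ _ _ _ _ _ _ D f (@measurable_ln _))
  | |- measurable_fun ?D (fun x => GRing.inv (@?f x)) =>
      apply: (@measurableT_comp _ _ _ _ _ _ _ D f (@measurable_invr _))
  | |- measurable_fun ?D (fun x => powR (@?f x) ?p) =>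
      apply: (@measurableT_comp _ _ _ _ _ _ _ D f (@measurable_powR _ p))
  | |- measurable_fun ?D (fun x => mule (@?f x) (@?g x)) =>
      apply: (@emeasurable_funM _ _ _ D f g)
  end.
Ltac mfun := repeat mstep; try assumption.

Section lebesgue_line.
Context {R : realType}.
Notation leb := (@lebesgue_measure R).
Implicit Types f : R -> \bar R.

(** The image of Lebesgue measure under the translation gives half-open intervals their length,
    which characterises Lebesgue measure. *)
Lemma integral_lebesgue_shift f (a : R) : measurable_fun [set: R] f ->
  (forall x, 0 <= f x)%E ->
  (\int[leb]_x f (x + a)%R = \int[leb]_x f x)%E.
Proof.
move=> mf f0.
have ms : measurable_fun setT ((fun x => x + a) : measurableTypeR R -> measurableTypeR R).
  exact: measurable_funD.
pose m : {measure set (measurableTypeR R) -> \bar R} :=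
  measure_function_pushforward__canonical__measure_function_Measure leb ms.
transitivity (\int[m]_x f x)%E.
  by rewrite /m/= (ge0_integral_pushforward ms)//= preimage_setT.
apply: eq_measure_integral => //= A mA _; apply/esym.
apply: (@lebesgue_measure_unique R m) => //= _ [[c e]] _ <-.
rewrite /m /= /pushforward.
rewrite (_ : _ @^-1` _ = `]c - a, e - a]%classic); last first.
  by apply/seteqP; split => x /=; rewrite !in_itv/= ltrBlDr lerBrDr.
by rewrite !lebesgue_measure_itv/= !lte_fin ltrD2r -!EFinD; case: ifPn => // _;
  congr EFin; ring.
Qed.

(** The image measure under x -> k x, multiplied by k, gives ]c, e] the mass k (e/k - c/k) = e -
    c. *)
Lemma integral_lebesgue_dilate f (k : R) : 0 < k -> measurable_fun [set: R] f ->
  (forall x, 0 <= f x)%E ->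
  (\int[leb]_x f x = k%:E * \int[leb]_x f (k * x)%R)%E.
Proof.
move=> k0 mf f0.
have ms : measurable_fun setT ((fun x => k * x) : measurableTypeR R -> measurableTypeR R).
  exact: measurable_funM.
pose m : {measure set (measurableTypeR R) -> \bar R} :=
  measure_function_pushforward__canonical__measure_function_Measure leb ms.
have k0' : 0 <= k by exact: ltW.
pose mk := mscale (NngNum k0') m.
transitivity (\int[mk]_x f x)%E; last first.
  rewrite /mk ge0_integral_mscale//=.
  by rewrite /m/= (ge0_integral_pushforward ms)//= preimage_setT.
apply: (@eq_measure_integral _ _ _ _ mk) => A mA _.
apply: (@lebesgue_measure_unique R mk) => // _ [[c e]] _ <-.
rewrite /mk /= /mscale/= /pushforward.
rewrite (_ : _ @^-1` _ = `]c / k, e / k]%classic); last first.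
  by apply/seteqP; split => x /=; rewrite !in_itv/= ltr_pdivrMr// ler_pdivlMr// mulrC.
rewrite !lebesgue_measure_itv/= !lte_fin ltr_pM2r ?invr_gt0//.
case: ifPn => _; last by rewrite mule0.
by rewrite -!EFinD -EFinM; congr EFin; field; rewrite gt_eqF.
Qed.

Lemma integral_FTC (f F : R -> R) (a b : R) : a < b ->
  (forall x, a <= x <= b -> is_derive x (1 : R) F (f x)) ->
  (forall x, a <= x <= b -> {for x, continuous f}) ->
  (\int[leb]_(x in `[a, b]) (f x)%:E = (F b - F a)%:E)%E.
Proof.
move=> ab dF cf.
have cF x : a <= x <= b -> {for x, continuous F}.
  by move=> /dF [dx _]; apply: differentiable_continuous; exact/derivable1_diffP.
rewrite (@continuous_FTC2 _ f F)// ?EFinB//.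
- apply: continuous_in_subspaceT => x /[!inE]/=; rewrite in_itv/=; exact: cf.
- split.
  + by move=> x; rewrite in_itv/= => /andP[/ltW ax /ltW xb];
      have [] := dF x _; rewrite ?ax ?xb.
  + by apply/cvg_at_right_filter; apply: cF; rewrite lexx ltW.
  + by apply/cvg_at_left_filter; apply: cF; rewrite lexx ltW.
- move=> x; rewrite in_itv/= => /andP[/ltW ax /ltW xb].
  rewrite derive1E; have xab : a <= x <= b by rewrite ax xb.
  by rewrite (@derive_val _ _ _ _ _ _ _ (dF _ xab)).
Qed.

(** The exponential density k e^(-k x) has total mass 1. *)
Lemma integral_expR_itv0y (k : R) : 0 < k ->
  (\int[leb]_(x in `]0%R, +oo[) (expR (- (k * x)))%:E = (k^-1)%:E)%E.
Proof.
move=> k0.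
have := @integral_exponential_pdf R k k0.
rewrite (_ : (fun x => _) =
    (EFin \o (fun x : R => k * expR (- k * x)) : R -> \bar R) \_ `[0, +oo[); last first.
  by apply/funext => x; rewrite /exponential_pdf /patch; case: ifP.
rewrite -integral_mkcond /= -integral_itv_obnd_cbnd; last first.
  by apply: measurable_funTS => /=; mfun.
under eq_integral do rewrite EFinM mulNr.
rewrite ge0_integralZl_EFin ?(ltW k0)//; last first.
  by apply: measurable_funTS; mfun.
move=> h; rewrite -[LHS]mul1e -(mulVf (lt0r_neq0 k0)) EFinM -muleA h.
by rewrite mule1.
Qed.

(** The integrand is unbounded at 0 when a < 1, so the primitive x^a / a is used on compact
    intervals that increase to ]0, 1]. *)
Lemma integral_powR_itv0c (a : R) : 0 < a ->
  (\int[leb]_(x in `]0%R, 1%R]) (x `^ (a - 1))%:E <= (a^-1)%:E)%E.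
Proof.
move=> a0.
(* The shift by 2 keeps the left endpoint strictly below 1. *)
pose F (n : nat) : set (measurableTypeR R) := `[n.+2%:R^-1, 1]%classic.
have -> : `]0, 1]%classic = \bigcup_n F n.
  apply/seteqP; split => [x|x [n _]]; rewrite /F/= !in_itv/=; last first.
    by move=> /andP[nx ->]; rewrite (lt_le_trans _ nx)// invr_gt0.
  move=> /andP[x0 x1].
  exists (Num.truncn x^-1) => //=; rewrite in_itv/= x1 andbT.
  rewrite invf_ple ?posrE//; apply: (le_trans (ltW (truncnS_gt _))).
  by rewrite ler_nat.
have mf n : measurable_fun (F n) (fun x : R => (x `^ (a - 1))%:E).
  by apply: measurable_funTS; mfun.
have ndF : nondecreasing_seq F.
  move=> m n mn; rewrite subsetEset => x; rewrite /F/= !in_itv/= => /andP[mx ->].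
  rewrite andbT (le_trans _ mx)// lef_pV2 ?posrE// ler_nat.
  by rewrite !ltnS.
have := @ge0_nondecreasing_set_cvg_integral _ (measurableTypeR R) R F
  (fun x : R => (x `^ (a - 1))%:E) leb ndF (fun=> measurable_itv _) mf
  (fun i x _ => (powR_ge0 x _ : (0 <= (x `^ _)%:E)%E)).
move=> /cvg_lim <-//; apply: lime_le.
  apply: ereal_nondecreasing_is_cvgn.
  apply: ge0_nondecreasing_set_nondecreasing_integral => //.
  - by move=> i; exact: measurable_itv.
  - by move=> i x _; rewrite lee_fin powR_ge0.
apply: nearW => n.
have n1 : n.+2%:R^-1 < 1 :> R by rewrite invf_lt1// ltr1n.
have dF (x : R) : n.+2%:R^-1 <= x <= 1 ->
    is_derive x 1 (fun x => a^-1 * x `^ a) (x `^ (a - 1)).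
  move=> /andP[nx _]; have x0 : 0 < x by rewrite (lt_le_trans _ nx)// invr_gt0.
  have := @is_deriveZ _ R^o _ (fun x => x `^ a) a^-1 _ _ _ (is_derive1_powR a x0).
  by rewrite scalerA mulVf ?gt_eqF// scale1r.
have cf (x : R) : n.+2%:R^-1 <= x <= 1 -> {for x, continuous (fun y : R => y `^ (a - 1))}.
  move=> /andP[nx _]; have x0 : 0 < x by rewrite (lt_le_trans _ nx)// invr_gt0.
  have [dx _] := is_derive1_powR (a - 1) x0.
  by apply: differentiable_continuous; exact/derivable1_diffP.
rewrite (integral_FTC n1 dF cf) lee_fin powR1 mulr1 lerBlDr lerDl.
by rewrite mulr_ge0 ?powR_ge0// invr_ge0 ltW.
Qed.

(** With k = 2 (|s| + 1), ln (x / k) <= x / k gives s ln x <= |s| (x / k + ln k), and |s| / k <= 1/2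
    costs half of the exponential decay. *)
Lemma powR_expR_bound (s x : R) : 1 <= x -> x `^ s * expR (- x) <=
  expR (`|s| * ln (2 * (`|s| + 1))) * expR (- (2^-1 * x)).
Proof.
move=> x1; have x0 : 0 < x by rewrite (lt_le_trans _ x1).
rewrite /powR gt_eqF// -!expRD ler_expR.
have lx0 : 0 <= ln x by rewrite ln_ge0.
have k0 : 0 < 2 * (`|s| + 1) by rewrite mulr_gt0// ltr_wpDl.
have k1 : 0 <= (2 * (`|s| + 1))^-1 by rewrite invr_ge0 ltW.
have := @ln_sublinear R (x / (2 * (`|s| + 1))).
rewrite divr_gt0// => /(_ isT) /ltW.
rewrite ln_div ?posrE// lerBlDr => h.
have h1 : s * ln x <= `|s| * ln x by rewrite ler_wpM2r// ler_norm.
have h2 : `|s| * ln x <= `|s| * (x / (2 * (`|s| + 1)) + ln (2 * (`|s| + 1))).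
  by rewrite ler_wpM2l.
have h3 : `|s| * (x / (2 * (`|s| + 1))) <= 2^-1 * x.
  have -> : `|s| * (x / (2 * (`|s| + 1))) = (2^-1 * x) * (`|s| / (`|s| + 1)).
    by field; rewrite gt_eqF// ltr_wpDl.
  rewrite ler_piMr ?mulr_ge0 ?(ltW x0)//.
  by rewrite ler_pdivrMr ?mul1r ?lerDl// ltr_wpDl.
by lra.
Qed.

Lemma gamma_fun_fin (a : R) : 0 < a ->
  (\int[leb]_(x in `]0%R, +oo[) (x `^ (a - 1) * expR (- x))%:E < +oo)%E.
Proof.
move=> a0.
rewrite (@itv_bndbnd_setU _ _ _ (BRight (1:R)))//; last by rewrite bnd_simp.
have mg : measurable_fun [set: R] (fun x : R => (x `^ (a - 1) * expR (- x))%:E).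
  by mfun.
rewrite ge0_integral_setU//=; last 3 first.
- exact: measurable_funTS.
- by move=> x _; rewrite lee_fin mulr_ge0 ?powR_ge0 ?expR_ge0.
- apply/disj_set2P; apply/seteqP; split => // x /= []; rewrite !in_itv/=.
  by move=> /andP[_ x1] /andP[/lt_geF]; rewrite x1.
rewrite lte_add_pinfty//.
  apply: (@le_lt_trans _ _ (a^-1)%:E); last exact: ltry.
  apply: le_trans (integral_powR_itv0c a0).
  apply: ge0_le_integral => //.
  - by move=> x _; rewrite lee_fin mulr_ge0 ?powR_ge0 ?expR_ge0.
  - exact: measurable_funTS.
  - by apply: measurable_funTS; mfun.
  - move=> x /=; rewrite in_itv/= => /andP[x0 _].
    by rewrite lee_fin ler_piMr ?powR_ge0// expR_le1 oppr_le0 ltW.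
pose C := expR (`|a - 1| * ln (2 * (`|a - 1| + 1))).
apply: (@le_lt_trans _ _ (C%:E * 2^-1^-1%:E)%E); last by rewrite -EFinM ltry.
rewrite -integral_expR_itv0y// -ge0_integralZl_EFin ?expR_ge0//; last first.
  by apply: measurable_funTS; mfun.
apply: (@le_trans _ _ (\int[leb]_(x in `]1%R, +oo[) (C%:E * (expR (- (2^-1 * x)))%:E))%E).
  apply: ge0_le_integral => //.
  - by move=> x _; rewrite lee_fin mulr_ge0 ?powR_ge0 ?expR_ge0.
  - exact: measurable_funTS.
  - by apply: measurable_funTS; mfun.
  - move=> x /=; rewrite in_itv/= andbT => x1.
    rewrite -EFinM lee_fin.
    by rewrite powR_expR_bound// ltW.
apply: ge0_subset_integral => //.
- by apply: measurable_funTS; mfun.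
- by move=> x _; rewrite -EFinM lee_fin mulr_ge0 ?expR_ge0.
- by apply: subset_itvr; rewrite bnd_simp.
Qed.

(** A zero integral would make f vanish almost everywhere on D, so [a, b], where f > 0, would be
    contained in a null set. *)
Lemma integral_gt0 (D : set R) (f : R -> R) (a b : R) : a < b -> measurable D ->
  `[a, b] `<=` D -> measurable_fun [set: R] f ->
  (forall x, 0 <= f x) -> (forall x, D x -> 0 < f x) ->
  (0 < \int[leb]_(x in D) (f x)%:E)%E.
Proof.
move=> ab mD abD mf f0 fp; rewrite lt_neqAle integral_ge0 ?andbT; last first.
  by move=> x _; rewrite lee_fin.
apply/eqP => /esym h.
have [] := (@ae_eq_integral_abs _ _ _ leb D mD (fun x => (f x)%:E) _).
  by apply: measurable_funTS; mfun.
move=> + _ => -[].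
  by rewrite -[RHS]h; apply: eq_integral => x _; rewrite gee0_abs// lee_fin.
move=> N [mN N0 subN].
have : (leb `[a, b] <= leb N)%E.
  apply: le_measure; rewrite ?inE//; apply: (subset_trans _ subN) => x abx /=.
  by move=> /(_ (abD _ abx)) [] /eqP; rewrite gt_eqF// fp//; exact: abD.
by rewrite N0 lebesgue_measure_itv/= lte_fin ab leNgt -EFinD lte_fin subr_gt0 ab.
Qed.

Lemma gamma_funE (a : R) : 0 < a ->
  (\int[leb]_(x in `]0%R, +oo[) (x `^ (a - 1) * expR (- x))%:E = (gamma_fun a)%:E)%E.
Proof.
move=> a0; rewrite /gamma_fun fineK// ge0_fin_numE ?gamma_fun_fin//.
by apply: integral_ge0 => x _; rewrite lee_fin mulr_ge0 ?powR_ge0 ?expR_ge0.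
Qed.

Lemma gamma_fun_gt0 (a : R) : 0 < a -> 0 < gamma_fun a.
Proof.
move=> a0; rewrite -lte_fin -gamma_funE//.
apply: (@integral_gt0 _ _ 1 2); rewrite ?ltr1n//.
- by move=> x /=; rewrite !in_itv/= => /andP[x1 _]; rewrite andbT (lt_le_trans _ x1).
- by mfun.
- by move=> x; rewrite mulr_ge0 ?powR_ge0 ?expR_ge0.
- by move=> x /=; rewrite in_itv/= andbT => x0; rewrite mulr_gt0 ?powR_gt0 ?expR_gt0.
Qed.

End lebesgue_line.

Section line_integrals.
Context {R : realType}.
Notation leb := (@lebesgue_measure R).

(** The substitution x -> k x in the gamma integral, extended by 0 to the whole line. *)
Lemma integral_gamma_rate (a k : R) : 0 < a -> 0 < k ->
  (\int[leb]_(x in `]0%R, +oo[) (x `^ (a - 1) * expR (- (k * x)))%:E =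
   (k `^ (- a) * gamma_fun a)%:E)%E.
Proof.
move=> a0 k0.
pose f := ((fun x : R => (x `^ (a - 1) * expR (- x))%:E) \_ `]0%R, +oo[)%E.
pose g x := (x `^ (a - 1) * expR (- (k * x)))%:E.
have f0 x : (0 <= f x)%E.
  by apply: erestrict_ge0 => y _; rewrite lee_fin mulr_ge0 ?powR_ge0 ?expR_ge0.
have mf : measurable_fun [set: R] f.
  by apply/(measurable_restrictT _ _).1 => //; apply: measurable_funTS; mfun.
have g0 x : (0 <= g x)%E by rewrite lee_fin mulr_ge0 ?powR_ge0 ?expR_ge0.
have mg : measurable_fun [set: R] g by rewrite /g; mfun.
have fk x : f (k * x) = ((k `^ (a - 1))%:E * (g \_ `]0%R, +oo[) x)%E.
  rewrite /f /g /patch !mem_setE !in_itv/= !andbT pmulr_rgt0//.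
  case: ifPn => x0; last by rewrite mule0.
  by rewrite powRM ?(ltW k0) ?(ltW x0)// -EFinM mulrA.
have -> : (k `^ (- a) * gamma_fun a)%:E =
    ((k `^ (- a))%:E * \int[leb]_x f x)%E.
  by rewrite EFinM -gamma_funE// integral_mkcond.
rewrite (integral_lebesgue_dilate k0)//.
under [in RHS]eq_integral do rewrite fk.
rewrite ge0_integralZl_EFin ?powR_ge0//; last 2 first.
- by move=> x _; apply: erestrict_ge0 => y _; exact: g0.
- by apply/(measurable_restrictT _ _).1 => //; apply: measurable_funTS.
rewrite !muleA -!EFinM -mulrA mulr_powRB1 ?(ltW k0)// -powRD; last first.
  by rewrite (gt_eqF k0) implybT.
by rewrite addNr powRr0 mul1e -integral_mkcond.
Qed.

(** The centred normal density of variance z / 2 has peak 1 / sqrt (pi z) and total mass 1. *)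
Lemma integral_gauss (z : R) : 0 < z ->
  (\int[leb]_x (expR (- (x ^+ 2 / z)))%:E = (Num.sqrt (pi * z))%:E)%E.
Proof.
move=> z0; have z2 : 0 <= z / 2 by rewrite divr_ge0// ltW.
have s0 : Num.sqrt (z / 2) != 0 by rewrite gt_eqF// sqrtr_gt0 divr_gt0.
have := integral_normal_pdf 0 (Num.sqrt (z / 2)).
rewrite normal_pdfE// /normal_peak /normal_fun.
have -> : Num.sqrt (z / 2) ^+ 2 * pi *+ 2 = pi * z.
  by rewrite sqr_sqrtr// -mulr_natr; field.
under eq_integral => x _.
  rewrite subr0 sqr_sqrtr// -(mulr_natr (z / 2)) divfK ?pnatr_eq0// mulNr EFinM; over.
have p0 : 0 < Num.sqrt (pi * z) by rewrite sqrtr_gt0 mulr_gt0// pi_gt0.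
rewrite ge0_integralZl_EFin; last 4 first.
- by [].
- by move=> x _; rewrite lee_fin expR_ge0.
- by mfun.
- by rewrite invr_ge0 ltW.
move=> h; rewrite -[LHS]mul1e -(divff (lt0r_neq0 p0)) EFinM -muleA h.
by rewrite mule1.
Qed.

Lemma integral_expR_itvcc (r t : R) : 0 < r -> 0 < t ->
  (\int[leb]_(s in `[0%R, t]) (expR (- (r * s)))%:E = ((1 - expR (- (r * t))) / r)%:E)%E.
Proof.
move=> r0 t0.
have dF (x : R) : 0 <= x <= t ->
    is_derive x 1 (fun s => - r^-1 * expR (- r * s)) (expR (- r * x)).
  move=> _; apply: is_derive_eq.
  by rewrite /GRing.scale/= mulr1 mulrCA mulrNN mulVf ?gt_eqF// mulr1.
have cf (x : R) : 0 <= x <= t -> {for x, continuous (fun y : R => expR (- r * y))}.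
  move=> _; apply: differentiable_continuous; exact/derivable1_diffP.
under eq_integral do rewrite -mulNr.
rewrite (integral_FTC t0 dF cf) mulr0 expR0 !mulNr; congr EFin.
by field; rewrite gt_eqF.
Qed.

Lemma integral_inv_itvcc (b t : R) : 0 < b -> 0 < t ->
  (\int[leb]_(s in `[0%R, t]) ((b + s)^-1)%:E = (ln (1 + t / b))%:E)%E.
Proof.
move=> b0 t0.
have dF (x : R) : 0 <= x <= t ->
    is_derive x 1 (fun s => ln (b + s)) ((b + x)^-1).
  move=> /andP[x0 _]; have bx : 0 < b + x by rewrite ltr_pwDl.
  have := is_derive1_ln bx => dl.
  by apply: is_derive_eq; rewrite /GRing.scale/= add0r mulr1.
have cf (x : R) : 0 <= x <= t -> {for x, continuous (fun y : R => (b + y)^-1)}.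
  move=> /andP[x0 _]; have bx : b + x != 0 by rewrite gt_eqF// ltr_pwDl.
  by apply: cvgV => //; apply: cvgD; [exact: cvg_cst|exact: cvg_id].
rewrite (integral_FTC t0 dF cf) addr0 -ln_div ?posrE ?addr_gt0//.
by congr (ln _)%:E; field; rewrite gt_eqF.
Qed.

(* Frullani: write [(1 - e^(-rt)) / r] as an integral of [e^(-rs)] over [s]. *)
Lemma integral_frullani (b t : R) : 0 < b -> 0 <= t ->
  (\int[leb]_(r in `]0%R, +oo[)
     ((1 - expR (- (r * t))) * (expR (- (b * r)) / r))%:E = (ln (1 + t / b))%:E)%E.
Proof.
move=> b0; rewrite le_eqVlt => /predU1P[<-|t0].
  rewrite mul0r addr0 ln1; apply: integral0_eq => r _.
  by rewrite mulr0 oppr0 expR0 subrr mul0r.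
(* Integrating in s first gives the left-hand side; integrating in r first leaves the integral of 1
   / (b + s) over [0, t]. *)
pose F (p : measurableTypeR R * measurableTypeR R) : \bar R :=
  ((\1_`]0%R, +oo[ p.1 * \1_`[0%R, t] p.2) * expR (- (p.1 * p.2)) * expR (- (b * p.1)))%:E.
have mF : measurable_fun setT F.
  have m1 : measurable_fun setT (fun p : measurableTypeR R * measurableTypeR R => p.1).
    exact: measurable_fst.
  have m2 : measurable_fun setT (fun p : measurableTypeR R * measurableTypeR R => p.2).
    exact: measurable_snd.
  rewrite /F; mfun.
  - exact: (measurableT_comp (measurable_indic (measurable_itv _))).
  - exact: (measurableT_comp (measurable_indic (measurable_itv _))).
have F0 p : (0 <= F p)%E by rewrite lee_fin !mulr_ge0 ?expR_ge0.
transitivity (\int[leb]_r \int[leb]_s F (r, s))%E.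
  rewrite [LHS]integral_mkcond; apply: eq_integral => r _.
  rewrite /patch /F /=; case: ifPn => [|rn]; last first.
    by rewrite integral0_eq// => s _; rewrite indicE (negbTE rn) !mul0r.
  move=> rin; move: (rin); rewrite inE/= in_itv/= andbT => r0.
  transitivity (\int[leb]_(s in `[0%R, t]) ((expR (- (b * r)))%:E * (expR (- (r * s)))%:E))%E.
    rewrite ge0_integralZl_EFin ?expR_ge0//; last first.
      by apply: measurable_funTS; mfun.
    by rewrite integral_expR_itvcc// -EFinM; congr EFin; ring.
  rewrite integral_mkcond; apply: eq_integral => s _.
  rewrite /patch !indicE rin; case: ifPn => sn; rewrite ?(negbTE sn) ?sn/=; last first.
    by rewrite mulr0 !mul0r.
  by rewrite -EFinM; congr EFin; ring.
rewrite (fubini_tonelli F mF F0).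
transitivity (\int[leb]_(s in `[0%R, t]) ((b + s)^-1)%:E)%E; last first.
  exact: integral_inv_itvcc.
rewrite [RHS]integral_mkcond; apply: eq_integral => s _.
rewrite /patch /F /=; case: ifPn => [|sn]; last first.
  by rewrite integral0_eq// => r _; rewrite !indicE (negbTE sn) mulr0 !mul0r.
move=> sin; move: (sin); rewrite inE/= in_itv/= => /andP[s0 _].
have bs : 0 < b + s by rewrite ltr_pwDl.
rewrite -(integral_expR_itv0y bs) [RHS]integral_mkcond; apply: eq_integral => r _.
rewrite /patch !indicE sin; case: ifPn => rn; rewrite ?(negbTE rn) ?rn/=; last first.
  by rewrite mul0r !mul0r.
by rewrite !mul1r -expRD; congr (expR _)%:E; ring.
Qed.

End line_integrals.

(** * Uniqueness of the Laplace transform on the line *)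

Section density.
Context d (T : measurableType d) (R : realType).
Variables (mu : {measure set T -> \bar R}) (f : T -> R).
Variables (mf : measurable_fun [set: T] f) (f0 : forall x, 0 <= f x).
Local Open Scope ereal_scope.

Import HBNNSimple.

(** Both sides are monotone limits over simple approximations of g, and on the indicator of a level
    set the identity is the definition of [mdensity]. *)
Lemma ge0_integral_mdensity (D : set T) (g : T -> \bar R) : measurable D ->
  measurable_fun D g -> (forall x, D x -> 0 <= g x) ->
  \int[mdensity mu mf f0]_(x in D) g x = \int[mu]_(x in D) (g x * (f x)%:E).
Proof.
move=> mD mg g0; pose g_ := nnsfun_approx mD mg.
have mfD : measurable_fun D (fun x => (f x)%:E).
  by apply: measurable_funTS; apply/measurable_EFinP.
have mgD n : measurable_fun D (fun x => (g_ n x)%:E).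
  by apply/measurable_EFinP; exact: measurable_funTS.
transitivity (limn (fun n => \int[mdensity mu mf f0]_(x in D) (g_ n x)%:E)).
  rewrite -monotone_convergence//=.
  - apply: eq_integral => x /[!inE] xD; apply/esym/cvg_lim => //=.
    exact: cvg_nnsfun_approx.
  - by move=> n x _; rewrite lee_fin.
  - by move=> x _ a b ab; rewrite lee_fin//; exact/lefP/nd_nnsfun_approx.
transitivity (limn (fun n => \int[mu]_(x in D) ((g_ n x)%:E * (f x)%:E))); last first.
  rewrite -monotone_convergence//=.
  - apply: eq_integral => x /[!inE] xD; apply/cvg_lim => //=.
    under eq_fun do rewrite muleC; rewrite muleC.
    by apply: cvgeMl => //; exact: cvg_nnsfun_approx.
  - by move=> n; exact: emeasurable_funM.
  - by move=> n x _; rewrite mule_ge0// lee_fin.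
  - move=> x _ a b ab; rewrite lee_wpmul2r ?lee_fin//.
    exact/lefP/nd_nnsfun_approx.
congr (limn _); apply/funext => n.
under [LHS]eq_integral do rewrite fimfunE -fsumEFin//.
rewrite ge0_integral_fsum//; last 2 first.
- by move=> y; exact/measurable_EFinP/measurable_funM.
- by move=> y x _; rewrite nnfun_muleindic_ge0.
have -> : \int[mu]_(x in D) ((g_ n x)%:E * (f x)%:E) =
    \int[mu]_(x in D) (\sum_(k \in range (g_ n))
      ((k * \1_(g_ n @^-1` [set k]) x)%:E * (f x)%:E)).
  apply: eq_integral => x _; rewrite fimfunE -fsumEFin// ge0_mule_fsuml// => y.
  by rewrite EFinM nnfun_muleindic_ge0.
rewrite [RHS]ge0_integral_fsum//; last 2 first.
- move=> y; apply: emeasurable_funM => //.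
  exact/measurable_EFinP/measurable_funM.
- by move=> y x _; rewrite mule_ge0 ?lee_fin// -lee_fin EFinM nnfun_muleindic_ge0.
apply: eq_fsbigr => r _.
rewrite integralZl_indic_nnsfun// integral_indic//=.
under [RHS]eq_integral do rewrite EFinM -muleA.
(* A negative r has an empty level set, since the approximation is nonnegative. *)
have [r0|r0] := leP 0%R r; last first.
  rewrite preimage_nnfun0// set0I measure0 mule0 integral0_eq// => x _.
  by rewrite indicE in_set0 mul0e mule0.
rewrite ge0_integralZl_EFin//; last 2 first.
- by move=> x _; rewrite mule_ge0 ?lee_fin.
- by apply: emeasurable_funM => //; exact/measurable_EFinP.
congr (_ * _); rewrite /= /mdensity setIC integral_mkcondr.
by apply: eq_integral => x _; rewrite epatch_indic muleC.
Qed.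

End density.

Section laplace_line.
Context {R : realType}.
Implicit Types m : {measure set (measurableTypeR R) -> \bar R}.
Local Notation D := (`[0%R, +oo[%classic : set (measurableTypeR R)).
Local Notation laplace m t := (\int[m]_(x in D) (expR (- (t * x)))%:E)%E.

(** A combination of exponentials e^(-u x) with u >= 0, so that its integral is determined by the
    Laplace transform. For s = 0 and suitable N and t it approximates the indicator of a
    half-line. *)
Let q (N : nat) (t s x : R) : R := (1 - expR (- (t * x))) ^+ N * expR (- (s * x)).

Let q_ge0 N t s x : 0 <= t -> D x -> 0 <= q N t s x.
Proof.
rewrite /= in_itv/= andbT => t0 x0; rewrite mulr_ge0 ?expR_ge0// exprn_ge0//.
by rewrite subr_ge0 expR_le1 oppr_le0 mulr_ge0.
Qed.

Let q_le1 N t s x : 0 <= t -> 0 <= s -> D x -> q N t s x <= 1.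
Proof.
rewrite /= in_itv/= andbT => t0 s0 x0.
have h : 0 <= 1 - expR (- (t * x)) by rewrite subr_ge0 expR_le1 oppr_le0 mulr_ge0.
rewrite mulr_ile1 ?exprn_ge0 ?expR_ge0 ?expR_le1 ?oppr_le0 ?mulr_ge0//.
by rewrite exprn_ile1// lerBlDr lerDl expR_ge0.
Qed.

Let mq N t s (E : set (measurableTypeR R)) : measurable_fun E (fun x => (q N t s x)%:E).
Proof. by apply: measurable_funTS; rewrite /q; mfun. Qed.

Let q_fin m N t s : (m setT < +oo)%E -> 0 <= t -> 0 <= s ->
  (\int[m]_(x in D) (q N t s x)%:E)%E \is a fin_num.
Proof.
move=> moo t0 s0; rewrite ge0_fin_numE; last first.
  by apply: integral_ge0 => x Dx; rewrite lee_fin q_ge0.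
apply: (@le_lt_trans _ _ (\int[m]_(x in D) 1)%E).
  apply: ge0_le_integral => //.
  - by move=> x Dx; rewrite lee_fin q_ge0.
  - by move=> x Dx; rewrite lee_fin q_le1.
rewrite integral_cst// mul1e (le_lt_trans _ moo)//.
by apply: le_measure => //; rewrite inE.
Qed.

(** Induction on N through q (N + 1) t s + q N t (t + s) = q N t s; the common term can be
    subtracted because its integral is finite. *)
Let q_eq m1 m2 N t s : (m1 setT < +oo)%E -> (m2 setT < +oo)%E ->
  (forall t, 0 <= t -> laplace m1 t = laplace m2 t) ->
  0 <= t -> 0 <= s ->
  (\int[m1]_(x in D) (q N t s x)%:E = \int[m2]_(x in D) (q N t s x)%:E)%E.
Proof.
move=> m1oo m2oo m12 t0; elim: N s => [|N IH] s s0.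
  by rewrite /q; under eq_integral do rewrite expr0 mul1r;
    under [RHS]eq_integral do rewrite expr0 mul1r; exact: m12.
have ts : 0 <= t + s by rewrite addr_ge0.
have split m : (\int[m]_(x in D) (q N.+1 t s x)%:E +
    \int[m]_(x in D) (q N t (t + s) x)%:E = \int[m]_(x in D) (q N t s x)%:E)%E.
  rewrite -ge0_integralD//; first last.
  - by move=> x Dx; rewrite lee_fin q_ge0.
  - by move=> x Dx; rewrite lee_fin q_ge0.
  apply: eq_integral => x _; rewrite -EFinD; congr EFin.
  by rewrite /q exprS (mulrDl t s x) opprD expRD; ring.
have := split m1; rewrite (IH _ s0) -(split m2) (IH _ ts).
by move=> /(congr1 (fun u => u - \int[m2]_(x in D) (q N t (t + s) x)%:E)%E);
  rewrite !addeK ?q_fin.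
Qed.

Let Bernoulli (a : R) n : 0 <= a <= 1 -> 1 - n%:R * a <= (1 - a) ^+ n.
Proof.
move=> /andP[a0 a1]; elim: n => [|n IH]; first by rewrite mul0r subr0 expr0.
rewrite exprS; apply: le_trans (ler_wpM2l _ IH); last by rewrite subr_ge0.
rewrite -natr1; have : 0 <= n%:R * a * a by rewrite !mulr_ge0.
by lra.
Qed.

Let th (c : R) (n : nat) := ((n ^ 2 + n)%:R * ln 2) / c.

Let th_ge0 c n : 0 < c -> 0 <= th c n.
Proof. by move=> c0; rewrite divr_ge0 ?(ltW c0)// mulr_ge0// ln_ge0// ler1n. Qed.

Let pow2E n : (2 ^ n)%:R = expR (n%:R * ln 2) :> R.
Proof. by rewrite natrX expRM_natl lnK// posrE. Qed.

(* With [e^(- th c n * c) = 2^-(n^2 + n)] the power [2^(n^2)] makes the limit the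
   exact indicator of [[c, +oo[], including at the threshold [x = c]. *)
Let q_cvg (c x : R) : 0 < c -> 0 <= x ->
  q (2 ^ (n ^ 2)) (th c n) 0 x @[n --> \oo] --> (\1_(`[c, +oo[%classic : set R) x : R).
Proof.
move=> c0 x0.
have ln2 : 0 < ln 2 :> R by rewrite ln_gt0// ltr1n.
have gz : (2^-1 ^+ n : R) @[n --> \oo] --> 0.
  by apply: cvg_expr; rewrite ger0_norm ?invr_ge0// invf_lt1// ltr1n.
have halfE n : 2^-1 ^+ n = expR (- (n%:R * ln 2)) :> R.
  by rewrite expRN -pow2E natrX exprVn.
have ax n : 0 <= expR (- (th c n * x)) <= 1.
  by rewrite expR_ge0 expR_le1 oppr_le0 mulr_ge0// th_ge0.
rewrite indicE; case: (boolP (x \in _)) => [|] xc.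
  have {}xc : c <= x by move: xc; rewrite inE/= in_itv/= andbT.
  (* For x >= c, Bernoulli's inequality gives the lower bound 1 - 2^(n^2) 2^-(n^2 + n) = 1 -
     2^-n. *)
  apply: (@squeeze_cvgr _ _ _ _ (fun n => 1 - 2^-1 ^+ n) (fun=> 1)).
  - apply: nearW => n; rewrite q_le1 ?th_ge0//; last by rewrite /= in_itv/= x0.
    rewrite andbT /q mul0r oppr0 expR0 mulr1.
    apply: le_trans (Bernoulli _ (ax n)); rewrite lerD2l lerN2 halfE pow2E -expRD ler_expR.
    have h : th c n * c <= th c n * x by rewrite ler_wpM2l// th_ge0.
    have : th c n * c = (n ^ 2 + n)%:R * ln 2 by rewrite /th divfK// gt_eqF.
    by rewrite natrD; lra.
  - rewrite -[X in _ --> X]subr0; apply: cvgB => //; exact: cvg_cst.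
  - exact: cvg_cst.
have {}xc : x < c.
  by move: xc; rewrite notin_setE/= in_itv/= andbT => /negP; rewrite -ltNge.
apply: (@squeeze_cvgr _ _ _ _ (fun=> 0) (fun n => 2^-1 ^+ n)) => //; last exact: cvg_cst.
have cx : 0 < c - x by rewrite subr_gt0.
near=> n.
rewrite q_ge0 ?th_ge0//=; last by rewrite in_itv/= x0.
rewrite /q mul0r oppr0 expR0 mulr1.
have e1 : 1 - expR (- (th c n * x)) <= expR (- expR (- (th c n * x))) by exact: expR_ge1Dx.
apply: (@le_trans _ _ (expR (- expR (- (th c n * x))) ^+ (2 ^ (n ^ 2)))).
  by rewrite lerXn2r ?nnegrE ?expR_ge0// subr_ge0; case/andP: (ax n).
rewrite -expRM_natl halfE ler_expR mulrN lerN2 pow2E -expRD.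
apply: le_trans (expR_ge1Dx _).
(* From n (c - x) >= 2 c and x < c follows n (c - x) - x >= c, which makes the exponent below at
   least n ln 2. *)
have nb : 2 * c / (c - x) <= n%:R by near: n; exact: nbhs_infty_ger.
have {}nb : 2 * c <= n%:R * (c - x) by rewrite -ler_pdivrMr.
have -> : (n ^ 2)%:R * ln 2 + - (th c n * x) =
   n%:R * ln 2 * ((n%:R * (c - x) - x) / c).
  by rewrite /th natrD natrX; field; rewrite gt_eqF.
apply: (@le_trans _ _ (n%:R * ln 2 * 1)); first by rewrite mulr1.
apply: ler_wpDl => //; rewrite ler_wpM2l ?mulr_ge0 ?(ltW ln2)//.
by rewrite ler_pdivlMr// mul1r; lra.
Unshelve. all: by end_near. Qed.

Let itvcy_eq m1 m2 (c : R) : (m1 setT < +oo)%E -> (m2 setT < +oo)%E ->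
  (forall t, 0 <= t -> laplace m1 t = laplace m2 t) ->
  0 < c -> m1 `[c, +oo[%classic = m2 `[c, +oo[%classic.
Proof.
move=> m1oo m2oo m12 c0.
have cvg m : (m setT < +oo)%E ->
    (\int[m]_(x in D) (q (2 ^ (n ^ 2)) (th c n) 0 x)%:E)%E @[n --> \oo]
      --> m `[c, +oo[%classic.
  move=> moo.
  have -> : m `[c, +oo[%classic = (\int[m]_(x in D) (\1_(`[c, +oo[%classic : set R) x)%:E)%E.
    rewrite integral_indic//=; congr (m _); apply/esym/setIidl.
    by apply: subset_itvr; rewrite bnd_simp ltW.
  apply: (@dominated_cvg _ _ _ m D _ _ _ (fun=> 1%E)) => //.
  - move=> x; rewrite /= in_itv/= andbT => x0.
    apply: cvg_EFin; [exact: nearW|exact: q_cvg].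
  - apply/integrableP; split => //.
    under eq_integral do rewrite abse1.
    rewrite integral_cst// mul1e (le_lt_trans _ moo)//.
    by apply: le_measure => //; rewrite inE.
  - move=> n x Dx; rewrite gee0_abs ?lee_fin ?q_le1 ?q_ge0 ?th_ge0//.
have := cvg m1 m1oo; under eq_fun do rewrite (q_eq _ m1oo m2oo m12 (th_ge0 _ c0) (lexx 0)).
by move=> h; apply: (cvg_unique _ h); [|exact: cvg].
Qed.

(** The half-lines [c, +oo[ are stable under intersection and generate the Borel sets. Those with c
    > 0 are reached by dominated convergence; those with c <= 0 carry the whole mass, which is the
    transform at 0. *)
Lemma laplace_line_inj m1 m2 : (m1 setT < +oo)%E -> (m2 setT < +oo)%E ->
  m1 `]-oo, 0%R[%classic = 0%E -> m2 `]-oo, 0%R[%classic = 0%E ->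
  (forall t, 0 <= t -> (\int[m1]_x (expR (- (t * x)))%:E = \int[m2]_x (expR (- (t * x)))%:E)%E) ->
  forall A, measurable A -> m1 A = m2 A.
Proof.
move=> m1oo m2oo m10 m20 m12.
have TD m t : m `]-oo, 0%R[%classic = 0%E -> (\int[m]_x (expR (- (t * x)))%:E = laplace m t)%E.
  move=> m0; rewrite (@ge0_negligible_integral _ (measurableTypeR R) R m setT `]-oo, 0%R[%classic)//.
  - by congr integral; rewrite setTD setCitvl.
  - by mfun.
have {}m12 t : 0 <= t -> laplace m1 t = laplace m2 t by move=> t0; rewrite -!TD// m12.
have neg m (c : R) : m `]-oo, 0%R[%classic = 0%E -> c <= 0 -> m `[c, +oo[%classic = m D.
  move=> m0 c0.
  have -> : `[c, +oo[%classic = `[c, 0%R[ `|` D :> set (measurableTypeR R).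
    by rewrite -itv_bndbnd_setU// bnd_simp.
  rewrite setUC measureU0// (subset_measure0 _ _ _ m0)//.
  by move=> x /=; rewrite !in_itv/= => /andP[].
have mDE m : laplace m 0 = m D.
  under eq_integral do rewrite mul0r oppr0 expR0.
  by rewrite integral_cst// mul1e.
apply: (@measure_unique _ R (measurableTypeR R) (@RGenCInfty.G R)
  (fun n => `[(- n%:R)%R, +oo[%classic) _ _ _ _ m1 m2) => //.
- exact: RGenCInfty.measurableE.
- move=> _ _ [x ->] [y ->]; exists (Num.max x y).
  by apply/seteqP; split => z /=; rewrite !in_itv/= !andbT ge_max => /andP.
- by move=> n; exists (- n%:R).
- apply/seteqP; split => // x _; exists (Num.truncn `|x|).+1 => //=.
  rewrite in_itv/= andbT lerNl; apply: le_trans (ltW (truncnS_gt _)).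
  by rewrite -normrN ler_norm.
- move=> _ [c ->]; have [c0|c0] := ltP 0 c; first exact: itvcy_eq.
  by rewrite !neg// -!mDE m12.
- by move=> k; apply: le_lt_trans m1oo; apply: le_measure => //; rewrite inE.
Qed.

End laplace_line.

(** * Definite matrices and Schur complements *)

Section definite.
Context {R : realType}.

Lemma quad_ge0 (n : nat) (u : 'rV[R]_n) : 0 <= (u *m u^T) 0 0.
Proof. by rewrite mxE sumr_ge0// => i _; rewrite mxE -expr2 sqr_ge0. Qed.

Lemma quad_gt0 (n : nat) (u : 'rV[R]_n) : u != 0 -> 0 < (u *m u^T) 0 0.
Proof.
move=> u0; rewrite lt_neqAle quad_ge0 andbT eq_sym; apply: contra u0.
rewrite mxE psumr_eq0 => [/allP h|i _]; last by rewrite mxE -expr2 sqr_ge0.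
apply/eqP/rowP => i; have /implyP/(_ isT) := h i (mem_index_enum _).
by rewrite !mxE -expr2 sqrf_eq0 => /eqP.
Qed.

Lemma quad_mx11 (z : R) (b : 'rV[R]_1) : (b *m z%:M *m b^T) 0 0 = z * b 0 0 ^+ 2.
Proof. by rewrite mul_mx_scalar -scalemxAl mxE mxE big_ord1 mxE -expr2. Qed.

Lemma pos_definite_congr (n : nat) (M A : 'M[R]_n) : M \in unitmx ->
  pos_definite n (M *m A *m M^T) <-> pos_definite n A.
Proof.
move=> Mu; split => -[sA pA]; split.
- apply: (can_inj (mulmxK (etrans (unitmx_tr M) Mu))).
  apply: (can_inj (mulKmx Mu)).
  by move: sA; rewrite !trmx_mul trmxK !mulmxA.
- move=> u u0; have := pA (u *m invmx M); rewrite trmx_mul !mulmxA mulmxKV//.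
  rewrite trmx_inv mulmxK ?unitmx_tr//; apply.
  by apply: contra u0 => /eqP h; rewrite -[u](mulmxKV Mu) h mul0mx.
- by rewrite !trmx_mul trmxK sA mulmxA.
- move=> u u0; rewrite -!mulmxA -trmx_mul !mulmxA; apply: pA.
  by apply: contra u0 => /eqP h; rewrite -[u](mulmxK Mu) h mul0mx.
Qed.

Lemma nonneg_definite_congr (n : nat) (M A : 'M[R]_n) :
  nonneg_definite n A -> nonneg_definite n (M *m A *m M^T).
Proof.
move=> [sA pA]; split; first by rewrite !trmx_mul trmxK sA mulmxA.
by move=> u; rewrite -!mulmxA -trmx_mul !mulmxA; apply: pA.
Qed.

Lemma pos_definite_nonneg (n : nat) (A : 'M[R]_n) :
  pos_definite n A -> nonneg_definite n A.
Proof.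
move=> [sA pA]; split => // v; have [->|v0] := eqVneq v 0; last exact/ltW/pA.
by rewrite mul0mx mul0mx mxE.
Qed.

Section bordered.
Variable n : nat.
Implicit Types (Y W : 'M[R]_n) (v : 'rV[R]_n) (z : R).

Let row_mx01_neq0 : (row_mx 0 1%:M : 'rV[R]_(n + 1)) != 0.
Proof.
rewrite row_mx_eq0 negb_and; apply/orP; right.
by apply/eqP => /matrixP /(_ 0 0) /eqP; rewrite !mxE oner_eq0.
Qed.

(** The new row and column come last, in agreement with [sym_mx], which reads the upper triangle
    column by column. *)
Definition bordered_mx Y v z : 'M[R]_(n + 1) := block_mx Y v^T v z%:M.

(** Block Gaussian elimination: the congruence that turns the block diagonal matrix of W and z into
    the bordered matrix with Schur complement W. *)
Definition elim_mx v z : 'M[R]_(n + 1) := block_mx 1%:M (z^-1 *: v^T) 0 1%:M.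

Lemma elim_mx_unit v z : elim_mx v z \in unitmx.
Proof. by rewrite unitmxE /elim_mx det_ublock !det1 mulr1 unitr1. Qed.

Lemma bordered_mxE W v z : z != 0 ->
  bordered_mx (W + z^-1 *: (v^T *m v)) v z =
  elim_mx v z *m block_mx W 0 0 z%:M *m (elim_mx v z)^T.
Proof.
move=> z0; rewrite /elim_mx tr_block_mx !mulmx_block.
rewrite !trmx1 !trmx0 !mul1mx !mul0mx !mulmx0 !mulmx1 !add0r !addr0.
rewrite linearZ/= trmxK mul_mx_scalar scalerA mulfV// scale1r.
by rewrite mul_scalar_mx scalerA mulfV// scale1r -scalemxAr.
Qed.

Lemma pos_definite_diag_block W z :
  pos_definite (n + 1) (block_mx W 0 0 z%:M) <-> pos_definite n W /\ 0 < z.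
Proof.
have quadE (a : 'rV[R]_n) (b : 'rV[R]_1) :
    (row_mx a b *m block_mx W 0 0 z%:M *m (row_mx a b)^T) 0 0 =
    (a *m W *m a^T) 0 0 + z * b 0 0 ^+ 2.
  rewrite tr_row_mx mul_row_block !mulmx0 addr0 add0r mul_row_col mxE quad_mx11.
  by [].
split=> [[sA pA]|[[sW pW] z0]].
- split; last first.
    have := pA (row_mx 0 1%:M); rewrite quadE !mul0mx mxE add0r mxE expr1n mulr1.
    apply; exact: row_mx01_neq0.
  split.
    by move: sA; rewrite tr_block_mx => /eq_block_mx[].
  move=> a a0; have := pA (row_mx a 0); rewrite quadE [X in X ^+ 2]mxE expr0n mulr0 addr0; apply.
  by rewrite row_mx_eq0 negb_and a0.
- split; first by rewrite tr_block_mx sW !trmx0 tr_scalar_mx.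
  move=> u; rewrite -[u]hsubmxK quadE => u0.
  have [a0|a0] := eqVneq (lsubmx u) 0; last first.
    by rewrite ltr_pwDl ?pW// mulr_ge0 ?sqr_ge0// ltW.
  rewrite a0 !mul0mx mxE add0r mulr_gt0// exprn_even_gt0//=.
  apply: contra u0 => /eqP b0; rewrite a0 (_ : rsubmx u = 0) ?row_mx0//.
  by apply/rowP => i; rewrite ord1 b0 mxE.
Qed.

Lemma pos_definite_bordered W v z : z != 0 ->
  pos_definite (n + 1) (bordered_mx (W + z^-1 *: (v^T *m v)) v z) <->
  pos_definite n W /\ 0 < z.
Proof.
move=> z0; rewrite bordered_mxE//.
apply: iff_trans (pos_definite_diag_block _ _).
exact: pos_definite_congr (elim_mx_unit _ _).
Qed.

Lemma det_bordered W v z : z != 0 ->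
  \det (bordered_mx (W + z^-1 *: (v^T *m v)) v z) = \det W * z.
Proof.
move=> z0; rewrite bordered_mxE// !det_mulmx det_tr /elim_mx !det_ublock.
by rewrite !det1 !mulr1 mul1r det_scalar1.
Qed.

Lemma tr_bordered Y v z : \tr (bordered_mx Y v z) = \tr Y + z.
Proof. by rewrite /bordered_mx mxtrace_block mxtrace_scalar mulr1n. Qed.

Definition border_pivot (X : 'M[R]_(n + 1)) : R := drsubmx X 0 0.
Definition border_schur (X : 'M[R]_(n + 1)) : 'M[R]_n :=
  ulsubmx X - (border_pivot X)^-1 *: ((dlsubmx X)^T *m dlsubmx X).

Lemma bordered_mxK (X : 'M[R]_(n + 1)) : X^T = X ->
  X = bordered_mx (border_schur X +
    (border_pivot X)^-1 *: ((dlsubmx X)^T *m dlsubmx X)) (dlsubmx X) (border_pivot X).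
Proof.
move=> sX; rewrite /border_schur subrK -[LHS]submxK /bordered_mx.
by rewrite -mx11_scalar trmx_dlsub sX.
Qed.

Lemma pos_definite_pivot (X : 'M[R]_(n + 1)) :
  pos_definite (n + 1) X -> 0 < border_pivot X.
Proof.
move=> [sX pX].
have /pX := row_mx01_neq0.
rewrite -[X in _ *m X *m _]submxK tr_row_mx mul_row_block !mul0mx !mul1mx.
by rewrite !add0r trmx0 trmx1 mul_row_col mulmx0 add0r mulmx1.
Qed.

(** A recursive form of positive definiteness, on which the inductions on the size for determinants,
    traces and measurability rest. *)
Lemma pos_definiteS (X : 'M[R]_(n + 1)) : pos_definite (n + 1) X <->
  [/\ X^T = X, 0 < border_pivot X & pos_definite n (border_schur X)].
Proof.
split=> [pX|[sX z0 pS]].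
  have z0 := pos_definite_pivot pX; have [sX _] := pX; split => //.
  have := pX; rewrite {1}(bordered_mxK sX).
  by case/pos_definite_bordered; rewrite ?gt_eqF.
rewrite (bordered_mxK sX); apply/pos_definite_bordered; last by split.
by rewrite gt_eqF.
Qed.

End bordered.

Lemma pos_definite0 (X : 'M[R]_0) : pos_definite 0 X.
Proof. by split=> [|v]; rewrite ?(thinmx0 v) ?eqxx// [X]flatmx0 trmx0. Qed.

Lemma pos_definite_det (n : nat) (X : 'M[R]_n) : pos_definite n X -> 0 < \det X.
Proof.
elim: n X => [|n IH] X; first by rewrite det_mx00.
rewrite -addn1 in X *; move=> /pos_definiteS [sX z0 pS].
by rewrite (bordered_mxK sX) det_bordered ?gt_eqF// mulr_gt0// IH.
Qed.

Lemma nonneg_definite_ulsub (m n : nat) (A : 'M[R]_(m + n)) :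
  nonneg_definite (m + n) A -> nonneg_definite m (ulsubmx A).
Proof.
move=> [sA pA]; split; first by rewrite trmx_ulsub sA.
move=> u; have := pA (row_mx u 0); rewrite -[X in _ *m X *m _]submxK tr_row_mx.
by rewrite mul_row_block !mul0mx !addr0 trmx0 mul_row_col mulmx0 addr0.
Qed.

Lemma nonneg_definite_drsub (m n : nat) (A : 'M[R]_(m + n)) :
  nonneg_definite (m + n) A -> nonneg_definite n (drsubmx A).
Proof.
move=> [sA pA]; split; first by rewrite trmx_drsub sA.
move=> u; have := pA (row_mx 0 u); rewrite -[X in _ *m X *m _]submxK tr_row_mx.
by rewrite mul_row_block !mul0mx !add0r trmx0 mul_row_col mulmx0 add0r.
Qed.

(** Elimination gives X = M D M^T with D block diagonal, so the trace is that of (M^T T M) D. Its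
    first block falls under the induction hypothesis and its last entry is a product of nonnegative
    numbers; no square root of X is involved. *)
Lemma tr_mulmx_pos_definite_ge0 (n : nat) (T X : 'M[R]_n) :
  nonneg_definite n T -> pos_definite n X -> 0 <= \tr (T *m X).
Proof.
elim: n T X => [|n IH] T X; first by rewrite /mxtrace big_ord0.
rewrite -addn1 in T X * => nT /pos_definiteS [sX z0 pS].
rewrite (bordered_mxK sX) bordered_mxE ?gt_eqF//.
set M := elim_mx _ _; set D := block_mx _ _ _ _.
rewrite mulmxA mxtrace_mulC !mulmxA.
have nT' := nonneg_definite_congr M^T nT; rewrite trmxK in nT'.
rewrite -[X in X *m D]submxK /D mulmx_block !mulmx0 addr0 add0r mxtrace_block.
rewrite addr_ge0// ?IH//; first exact: nonneg_definite_ulsub.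
rewrite add0r mul_mx_scalar mxtraceZ mulr_ge0 ?(ltW z0)// /mxtrace big_ord1.
have [_ /(_ 1%:M)] := nonneg_definite_drsub nT'.
by rewrite mul1mx trmx1 mulmx1.
Qed.

Lemma nonneg_definite_shift (n : nat) (X : 'M[R]_n) (e : R) : 0 < e ->
  nonneg_definite n X -> pos_definite n (X + e%:M).
Proof.
move=> e0 [sX pX]; split; first by rewrite linearD/= tr_scalar_mx sX.
move=> v v0; rewrite mulmxDr mulmxDl mxE ltr_wpDl//.
by rewrite mul_mx_scalar -scalemxAl mxE mulr_gt0// quad_gt0.
Qed.

(** Replaces a passage to the limit along X + I / (k + 1) when a closed inequality is carried from
    the open cone to its closure. *)
Lemma ge0_limit (a b : R) : (forall k : nat, 0 <= a + k.+1%:R^-1 * b) -> 0 <= a.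
Proof.
move=> h; rewrite leNgt; apply/negP => a0.
have b0 : 0 < b.
  by rewrite ltNge; apply/negP => b0; have := h 0; rewrite invr1 mul1r; lra.
have na : 0 < - a by rewrite oppr_gt0.
have := h (Num.truncn (b / - a)); set k := (Num.truncn _).+1.
have : b / - a < k%:R by exact: truncnS_gt.
rewrite ltr_pdivrMr// -ltr_pdivrMl// => kb; rewrite leNgt => /negP; apply.
by rewrite -ltrBDl sub0r.
Qed.

Lemma tr_mulmx_ge0 (n : nat) (T X : 'M[R]_n) :
  nonneg_definite n T -> nonneg_definite n X -> 0 <= \tr (T *m X).
Proof.
move=> nT nX; apply: (@ge0_limit _ (\tr T)) => k.
have k0 : 0 < k.+1%:R^-1 :> R by rewrite invr_gt0.
have := tr_mulmx_pos_definite_ge0 nT (nonneg_definite_shift k0 nX).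
by rewrite mulmxDr mul_mx_scalar mxtraceD mxtraceZ.
Qed.

(** Presents the closed cone as a countable intersection of translates of the open one, hence as a
    measurable set. *)
Lemma nonneg_definiteP (n : nat) (X : 'M[R]_n) :
  nonneg_definite n X <-> forall k : nat, pos_definite n (X + (k.+1%:R^-1)%:M).
Proof.
split=> [nX k|pX]; first by apply: nonneg_definite_shift; rewrite ?invr_gt0.
split.
  have [/eqP + _] := pX 0; rewrite linearD/= tr_scalar_mx.
  by rewrite (inj_eq (addIr _)) => /eqP.
move=> v; apply: (@ge0_limit _ ((v *m v^T) 0 0)) => k.
have := pos_definite_nonneg (pX k) => -[_ /(_ v)].
by rewrite mulmxDr mulmxDl mxE mul_mx_scalar -scalemxAl [X in _ + X]mxE.
Qed.

Lemma measurable_symmetric (n : nat) : measurable [set X : 'M[R]_n | X^T = X].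
Proof.
have -> : [set X : 'M[R]_n | X^T = X] =
    \bigcap_(i in [set: 'I_n]) \bigcap_(j in [set: 'I_n]) [set X | X i j = X j i].
  apply/seteqP; split => [X /= sX i _ j _ /=|X h]; first by rewrite -{1}sX mxE.
  by apply/matrixP => i j; rewrite mxE; apply: h.
apply: fin_bigcap_measurable => // i _; apply: fin_bigcap_measurable => // j _.
have : measurable_fun setT (fun X : 'M[R]_n => X i j - X j i).
  by apply: measurable_funB; exact: measurable_entry.
move=> /(_ measurableT [set 0] (measurable_set1 _)); rewrite setTI; congr measurable.
by apply/seteqP; split => X /= => [/eqP|->]; rewrite ?subrr// subr_eq0 => /eqP.
Qed.

(** The definition quantifies over uncountably many vectors; the Schur recursion replaces this by
    symmetry, a positive pivot and the same condition on a smaller matrix. *)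
Lemma measurable_pos_definite (n : nat) : measurable (@pos_definite R n).
Proof.
elim: n => [|n IH].
  by rewrite (_ : pos_definite 0 = setT)//; apply/seteqP; split => // X _; exact: pos_definite0.
rewrite -addn1.
have -> : pos_definite (n + 1) = [set X : 'M[R]_(n + 1) | X^T = X] `&`
    ((@border_pivot n) @^-1` `]0, +oo[ `&` (@border_schur n) @^-1` pos_definite n).
  apply/seteqP; split => X /=.
    by move=> /pos_definiteS[? ? ?]; rewrite in_itv/= andbT.
  by rewrite in_itv/= andbT => -[? [? ?]]; apply/pos_definiteS.
have mp : measurable_fun setT (@border_pivot n).
  rewrite (_ : @border_pivot n = fun X => X (rshift n 0) (rshift n 0)).
    exact: measurable_entry.
  by apply/funext => X; rewrite /border_pivot !mxE.
apply: measurableI; first exact: measurable_symmetric.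
apply: measurableI; first by rewrite -[X in measurable X]setTI; exact: mp.
rewrite -[X in measurable X]setTI.
suff ms : measurable_fun setT (@border_schur n) by exact: ms.
apply/measurable_fun_mxP => i j; under eq_fun do rewrite !mxE big_ord1 !mxE.
rewrite -/(measurable_fun _ _).
by mfun; first [exact: mp | exact: measurable_entry].
Qed.

Lemma measurable_nonneg_definite (n : nat) : measurable (@nonneg_definite R n).
Proof.
have -> : @nonneg_definite R n = \bigcap_(k : nat)
    (fun X : 'M[R]_n => X + (k.+1%:R^-1)%:M) @^-1` (pos_definite n).
  apply/seteqP; split => X.
    by move=> /nonneg_definiteP h k _; exact: h.
  by move=> h; apply/nonneg_definiteP => k; exact: h.
apply: bigcapT_measurable => k; rewrite -[X in measurable X]setTI.
suff ms : measurable_fun setT (fun X : 'M[R]_n => X + (k.+1%:R^-1)%:M).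
  by apply: ms => //; exact: measurable_pos_definite.
apply/measurable_fun_mxP => i j; under eq_fun do rewrite mxE.
rewrite -/(measurable_fun _ _); by mfun; exact: measurable_entry.
Qed.

Lemma measurable_trace_sphere (n : nat) : measurable (@trace_sphere R n).
Proof.
apply: measurableI; first exact: measurable_nonneg_definite.
rewrite -[X in measurable X]setTI.
exact: (@measurable_mxtrace R n measurableT [set 1] (measurable_set1 _)).
Qed.

End definite.

(** * Uniqueness of the Laplace transform on the cone *)

Section laplace_family.
Context {R : realType} d (T : measurableType d) (I : eqType).
Variable X : I -> T -> R.
Hypothesis mX : forall i, measurable_fun [set: T] (X i).
Hypothesis X0 : forall i x, 0 <= X i x.
Implicit Types m : {measure set T -> \bar R}.

Let w (s : seq I) (t : I -> R) (x : T) : R := expR (- \sum_(i <- s) t i * X i x).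

Let mw s t : measurable_fun [set: T] (w s t).
Proof.
rewrite /w; mfun.
by apply: measurable_sum => i; apply: measurable_funM => //; exact: mX.
Qed.

Let w0 s t x : 0 <= w s t x. Proof. exact: expR_ge0. Qed.

Let w1 s t x : (forall i, 0 <= t i) -> w s t x <= 1.
Proof.
move=> t0; rewrite /w expR_le1 oppr_le0 sumr_ge0// => i _.
by rewrite mulr_ge0.
Qed.

Let integral_ind m (B : set T) (mB : measurable B) s t :
  (\int[m]_(x in B) (w s t x)%:E =
   \int[mdensity m (measurable_indic mB : measurable_fun setT (\1_B : T -> R))
      (fun x => ler0n _ _)]_x (w s t x)%:E)%E.
Proof.
rewrite ge0_integral_mdensity//; last 2 first.
- by apply/measurable_EFinP; exact: mw.
- by move=> x _; rewrite lee_fin w0.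
by rewrite integral_mkcond; apply: eq_integral => x _; rewrite epatch_indic.
Qed.

(** Induction on the family. The event for the variable j is absorbed into the measure as an
    indicator density. The restricted measures have equal transforms in the other variables: with
    these exponentials as density, the images under [X j] have the same Laplace transform, hence the
    same mass on [A j]. *)
Lemma laplace_family_inj (s : seq I) m1 m2 : uniq s ->
  (m1 setT < +oo)%E -> (m2 setT < +oo)%E ->
  (forall t : I -> R, (forall i, 0 <= t i) ->
    (\int[m1]_x (expR (- \sum_(i <- s) t i * X i x))%:E =
     \int[m2]_x (expR (- \sum_(i <- s) t i * X i x))%:E)%E) ->
  forall A : I -> set R, (forall i, measurable (A i)) ->
    m1 [set x | forall i, i \in s -> A i (X i x)] =
    m2 [set x | forall i, i \in s -> A i (X i x)].
Proof.
elim: s m1 m2 => [|j s IH] m1 m2 us m1oo m2oo m12 A mA.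
  have -> : [set x | forall i, i \in [::] -> A i (X i x)] = setT by apply/seteqP.
  have := m12 (fun=> 0) (fun=> lexx _).
  under eq_integral do rewrite big_nil oppr0 expR0.
  under [in X in _ = X -> _]eq_integral do rewrite big_nil oppr0 expR0.
  by rewrite !integral_cst// !mul1e.
have [js us'] : j \notin s /\ uniq s by apply/andP.
have mB : measurable (X j @^-1` A j).
  by rewrite -[X in measurable X]setTI; apply: mX.
pose dm m : {measure set T -> \bar R} := mdensity m (measurable_indic mB :
  measurable_fun setT (\1_(X j @^-1` A j) : T -> R)) (fun x => ler0n _ _).
have dmE m E : measurable E -> dm m E = m (E `&` X j @^-1` A j).
  by move=> mE; rewrite /dm/= /mdensity integral_indic// setIC.
have mS : measurable [set x | forall i, i \in s -> A i (X i x)].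
  have -> : [set x | forall i, i \in s -> A i (X i x)] =
      \bigcap_(i in [set` s]) (X i @^-1` A i).
    by apply/seteqP; split => x /= h i; apply: h.
  apply: fin_bigcap_measurable => // i _.
  by rewrite -[X in measurable X]setTI; apply: mX.
have SE : [set x | forall i, i \in j :: s -> A i (X i x)] =
    [set x | forall i, i \in s -> A i (X i x)] `&` X j @^-1` A j.
  apply/seteqP; split => x /=.
    by move=> h; split => [i si|]; apply: h; rewrite inE ?si ?orbT ?eqxx.
  by move=> [h1 h2] i; rewrite inE => /predU1P[->|/h1].
rewrite SE -!dmE//; apply: (IH (dm m1) (dm m2)) => //.
- by rewrite dmE// setTI (le_lt_trans _ m1oo)// le_measure// inE.
- by rewrite dmE// setTI (le_lt_trans _ m2oo)// le_measure// inE.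
move=> t t0; rewrite -!integral_ind.
pose mj : measurable_fun setT (X j : T -> measurableTypeR R) := mX j.
pose p m : {measure set (measurableTypeR R) -> \bar R} :=
  measure_function_pushforward__canonical__measure_function_Measure
    (mdensity m (mw s t) (w0 s t)) mj.
have pfin m : (m setT < +oo)%E -> (p m setT < +oo)%E.
  move=> moo; rewrite /p/= /pushforward preimage_setT /mdensity.
  apply: (@le_lt_trans _ _ (\int[m]_x 1)%E); last by rewrite integral_cst// mul1e.
  apply: ge0_le_integral => //.
  - by move=> x _; rewrite lee_fin w0.
  - by apply/measurable_EFinP; exact: mw.
  - by move=> x _; rewrite lee_fin w1.
have pneg m : p m `]-oo, 0%R[%classic = 0%E.
  rewrite /p/= /pushforward (_ : _ @^-1` _ = set0) ?measure0//.
  by apply/seteqP; split => // x /=; rewrite in_itv/= ltNge X0.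
have plap m (t' : R) : (\int[p m]_x (expR (- (t' * x)))%:E =
    \int[m]_x (expR (- \sum_(i <- j :: s) (if i == j then t' else t i) * X i x))%:E)%E.
  rewrite /p (ge0_integral_pushforward mj)//=; last by mfun.
  rewrite preimage_setT ge0_integral_mdensity//; last first.
    by mfun; exact: mX.
  apply: eq_integral => x _; rewrite -EFinM -expRD big_cons eqxx opprD.
  congr (expR (_ - _))%:E; apply: eq_big_seq => i si.
  by case: eqP => // ij; rewrite -ij si in js.
apply: (laplace_line_inj (pfin _ m1oo) (pfin _ m2oo) (pneg _) (pneg _)).
  by move=> t' t'0; rewrite !plap m12// => i; case: ifP.
exact: mA.
Qed.

End laplace_family.

Section laplace_matrix.
Context {R : realType} (d : nat).
Implicit Types mu nu : probability 'M[R]_d R.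

Let rect (A : 'I_(d * d) -> set R) : set 'M[R]_d :=
  [set Z | forall k, A k (mxvec Z 0 k)].

Let mrect A : (forall k, measurable (A k)) -> measurable (rect A).
Proof.
move=> mA; have -> : rect A = \bigcap_(k in [set: 'I_(d * d)])
    ((fun Z : 'M[R]_d => mxvec Z 0 k) @^-1` A k).
  by apply/seteqP; split => Z /= h k; [move=> _|]; apply: h.
apply: fin_bigcap_measurable => // k _; case/mxvec_indexP: k => i j.
rewrite -[X in measurable X]setTI; under eq_fun do rewrite mxvecE.
exact: measurable_entry.
Qed.

Lemma matrix_measure_unique (m1 m2 : {measure set 'M[R]_d -> \bar R}) :
  (m1 setT < +oo)%E ->
  (forall A : 'I_(d * d) -> set R, (forall k, measurable (A k)) ->
    m1 [set Z | forall k, A k (mxvec Z 0 k)] =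
    m2 [set Z | forall k, A k (mxvec Z 0 k)]) ->
  forall B, measurable B -> m1 B = m2 B.
Proof.
move=> m1oo m12.
pose G : set (set 'M[R]_d) :=
  [set B | exists2 A, forall k, measurable (A k) & B = rect A].
have GT : G setT by exists (fun=> setT) => //; apply/seteqP; split.
apply: (@measure_unique _ _ _ G (fun=> setT)) => //.
- apply/seteqP; split => B.
    apply: smallest_sub; first exact: smallest_sigma_algebra.
    rewrite -bigcup_seq; apply: bigcup_sub => k _ C [E mE <-] /=.
    apply: sub_sigma_algebra; exists (fun k' => if k' == k then E else setT).
      by move=> k'; case: ifP.
    rewrite setTI; apply/seteqP; split => Z /=; last by move=> /(_ k); rewrite eqxx.
    by move=> EZ k'; case: eqP => // ->.
  apply: smallest_sub; first exact: sigma_algebra_measurable.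
  by move=> _ [A mA ->]; exact: mrect.
- move=> _ _ [A mA ->] [B mB ->]; exists (fun k => A k `&` B k).
    by move=> k; exact: measurableI.
  apply/seteqP; split => Z /=; first by move=> [h1 h2] k; split; [apply: h1|apply: h2].
  by move=> h; split => k; have [] := h k.
- by apply/seteqP; split => // x _; exists 0%N.
- by move=> _ [A mA ->]; exact: m12.
Qed.

(** An off-diagonal entry of Z can be negative and is not tr (T Z) for any T in the cone. The
    rank-one matrix u^T u with u = e_i + e_j lies in the cone and still detects Z i j. *)
Let probe (i j : 'I_d) : 'M[R]_d :=
  let u : 'rV[R]_d := delta_mx 0 i + delta_mx 0 j in u^T *m u.

Let probe_nonneg i j : nonneg_definite d (probe i j).
Proof.
split; first by rewrite /probe trmx_mul trmxK.
move=> v; rewrite /probe; set u := delta_mx 0 i + _.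
have -> : v *m (u^T *m u) *m v^T = (v *m u^T) *m (v *m u^T)^T.
  by rewrite trmx_mul trmxK !mulmxA.
exact: quad_ge0.
Qed.

Let tr_probe i j (Z : 'M[R]_d) : Z^T = Z ->
  \tr (probe i j *m Z) = Z i i + Z j j + 2 * Z i j.
Proof.
move=> sZ; have sE a b : Z a b = Z b a by rewrite -{1}sZ mxE.
rewrite /probe -mulmxA mxtrace_mulC.
rewrite mulmxDl -!rowE /mxtrace big_ord1 linearD/= !trmx_delta mulmxDr.
by rewrite -!colE !mxE (sE j i); ring.
Qed.

(** The maximum makes the coordinate nonnegative on all matrices, as [laplace_family_inj] requires;
    on the cone it changes nothing. *)
Let X (ij : 'I_d * 'I_d) (Z : 'M[R]_d) : R :=
  Num.max 0 (\tr (probe ij.1 ij.2 *m Z)).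

Let mX ij : measurable_fun setT (X ij).
Proof.
apply: measurable_maxr => //.
exact: (measurableT_comp (@measurable_mxtrace R d) (@measurable_mulmxl R d _)).
Qed.

Let XE ij Z : nonneg_definite d Z -> X ij Z = \tr (probe ij.1 ij.2 *m Z).
Proof. by move=> nZ; apply/max_idPr; exact: (tr_mulmx_ge0 (probe_nonneg _ _) nZ). Qed.

Let Y (Z : 'M[R]_d) : 'M[R]_d := \matrix_(i, j) X (i, j) Z.

Let mY : measurable_fun setT Y.
Proof. apply/measurable_fun_mxP => i j; under eq_fun do rewrite mxE.
exact: mX.
Qed.

(** The diagonal coordinates are 4 Z i i, whence the factors 4^-1. *)
Let unprobe (Z : 'M[R]_d) : 'M[R]_d :=
  \matrix_(i, j) (2^-1 * (Z i j - 4^-1 * Z i i - 4^-1 * Z j j)).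

Let munprobe : measurable_fun setT unprobe.
Proof.
apply/measurable_fun_mxP => i j; under eq_fun do rewrite mxE.
rewrite -/(measurable_fun _ _).
by mfun; exact: measurable_entry.
Qed.

Let unprobeK Z : nonneg_definite d Z -> unprobe (Y Z) = Z.
Proof.
move=> nZ; have [sZ _] := nZ.
by apply/matrixP => i j; rewrite !mxE !XE//= !tr_probe//; field.
Qed.

(* The coordinates [tr (probe i j * Z)] of a nonnegative definite [Z] are
   nonnegative and determine [Z], and their joint Laplace transform is a
   restriction of that of [Z]. *)
Lemma laplace_matrix_inj mu nu :
  mu (nonneg_definite d) = 1%E -> nu (nonneg_definite d) = 1%E ->
  (forall T : 'M[R]_d, nonneg_definite d T ->
    (\int[mu]_Z (expR (- \tr (T *m Z)))%:E =
     \int[nu]_Z (expR (- \tr (T *m Z)))%:E)%E) ->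
  forall B, measurable B -> mu B = nu B.
Proof.
move=> mu1 nu1 munu.
have mN := @measurable_nonneg_definite R d.
have N0 (m : probability 'M[R]_d R) :
    m (nonneg_definite d) = 1%E -> m (~` nonneg_definite d) = 0%E.
  by move=> m1; rewrite probability_setC// m1 subee.
(* A law carried by the cone, where [unprobe] inverts [Y], is determined by its image under [Y]. *)
have onN (m : probability 'M[R]_d R) : m (nonneg_definite d) = 1%E ->
    forall B, measurable B -> m B = m (Y @^-1` (unprobe @^-1` B)).
  move=> m1 B mB.
  have mB' : measurable (Y @^-1` (unprobe @^-1` B)).
    rewrite -[X in measurable X]setTI; apply: mY => //.
    by rewrite -[X in measurable X]setTI; exact: munprobe.
  have cut C : measurable C -> m C = m (C `&` nonneg_definite d).
    move=> mC; have mCI := measurableI _ _ mC mN; have mCD := measurableD mC mN.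
    have C0 : m (C `\` nonneg_definite d) = 0%E.
      apply: (subset_measure0 mCD _ _ (N0 _ m1)); first exact: measurableC.
      by move=> Z [].
    by rewrite -[in LHS](setUIDK C (nonneg_definite d)) measureU0.
  rewrite (cut _ mB) (cut _ mB'); congr (m _); apply/seteqP.
  by split => Z /= [BZ nZ]; split => //; move: BZ; rewrite unprobeK.
move=> B mB; rewrite (onN _ mu1 _ mB) (onN _ nu1 _ mB).
pose p (m : probability 'M[R]_d R) : {measure set 'M[R]_d -> \bar R} :=
  measure_function_pushforward__canonical__measure_function_Measure m mY.
have mB' : measurable (unprobe @^-1` B).
  by rewrite -[X in measurable X]setTI; exact: munprobe.
apply: (@matrix_measure_unique (p mu) (p nu)) => //.
  by rewrite /p/= /pushforward preimage_setT probability_setT ltry.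
move=> A mA; rewrite /p/= /pushforward.
pose s := enum (('I_d * 'I_d)%type : finType).
have -> : Y @^-1` [set Z | forall k, A k (mxvec Z 0 k)] =
    [set Z | forall ij, ij \in s -> A (mxvec_index ij.1 ij.2) (X ij Z)].
  apply/seteqP; split => Z /= h.
    by move=> [i j] _; have := h (mxvec_index i j); rewrite mxvecE mxE.
  move=> k; case/mxvec_indexP: k => i j; rewrite mxvecE mxE.
  by apply: (h (i, j)); rewrite mem_enum.
have X0 ij Z : 0 <= X ij Z by rewrite le_max lexx.
have fin (m : probability 'M[R]_d R) : (m setT < +oo)%E.
  by rewrite probability_setT ltry.
apply: (@laplace_family_inj _ _ _ _ X mX X0 s mu nu (enum_uniq _) (fin _) (fin _) _
  (fun ij => A (mxvec_index ij.1 ij.2))) => // t t0.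
pose T := \sum_(ij <- s) t ij *: probe ij.1 ij.2.
have nT : nonneg_definite d T.
  rewrite /T; elim: (s) => [|ij s' [sT pT]].
    rewrite big_nil; split; first by rewrite trmx0.
    by move=> v; rewrite mulmx0 mul0mx mxE.
  have [sP pP] := probe_nonneg ij.1 ij.2.
  rewrite big_cons; split; first by rewrite linearD linearZ/= sP sT.
  move=> v; rewrite mulmxDr mulmxDl mxE addr_ge0//.
  by rewrite -scalemxAr -scalemxAl mxE mulr_ge0.
have TE (m : probability 'M[R]_d R) : m (nonneg_definite d) = 1%E ->
    (\int[m]_Z (expR (- \sum_(ij <- s) t ij * X ij Z))%:E =
     \int[m]_Z (expR (- \tr (T *m Z)))%:E)%E.
  move=> m1; apply: ge0_ae_eq_integral => //.
  - mfun; apply: measurable_sum => ij.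
    by apply: measurable_funM => //; exact: mX.
  - mfun.
    exact: (measurableT_comp (@measurable_mxtrace R d) (@measurable_mulmxl R d _)).
  - exists (~` nonneg_definite d); split; [exact: measurableC|exact: N0|].
    move=> Z /= h nZ; apply: h => _; congr (expR (- _))%:E.
    rewrite /T mulmx_suml linear_sum/=; apply: eq_bigr => ij _.
    by rewrite XE// -scalemxAl linearZ.
by rewrite TE// TE// munu.
Qed.

End laplace_matrix.

(** * Lebesgue measure on symmetric matrices *)

Section lebesgue_tuple_theory.
Context {R : realType}.
Notation leb := (@lebesgue_measure R).

Lemma integral_lebesgue_tuple0 (F : 0.-tuple R -> \bar R) :
  (\int[lebesgue_tuple 0]_t F t = F [tuple])%E.
Proof.
rewrite (_ : F = cst (F [tuple])).
  by rewrite /= integral_dirac// diracT mul1e.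
by apply/funext => t; rewrite tuple0.
Qed.

Lemma integral_lebesgue_tupleS (n : nat) (F : n.+1.-tuple R -> \bar R) :
  measurable_fun setT F -> (forall t, 0 <= F t)%E ->
  (\int[lebesgue_tuple n.+1]_t F t =
   \int[leb]_x \int[lebesgue_tuple n]_t F [tuple of x :: t])%E.
Proof.
move=> mF F0.
have mc : measurable_fun setT
    (fun x : measurableTypeR R * n.-tuple R => [tuple of x.1 :: x.2] : n.+1.-tuple R).
  exact: measurable_cons.
rewrite /= (ge0_integral_pushforward mc)//= preimage_setT.
rewrite (fubini_tonelli1 (F \o _))//.
- exact: measurableT_comp.
- by move=> x; exact: F0.
Qed.

(** Tonelli's theorem isolates the first coordinate. Indexing the shift by [nat] lets the induction
    pass to the tail with [a i.+1]. *)
Lemma integral_lebesgue_tuple_shift (n : nat) (a : nat -> R) (F : n.-tuple R -> \bar R) :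
  measurable_fun setT F -> (forall t, 0 <= F t)%E ->
  (\int[lebesgue_tuple n]_t F [tuple (tnth t i + a i)%R | i < n] =
   \int[lebesgue_tuple n]_t F t)%E.
Proof.
elim: n a F => [|n IH] a F mF F0.
  by rewrite !integral_lebesgue_tuple0; congr F; exact: tuple0.
have ma : measurable_fun setT
    (fun t : n.+1.-tuple R => [tuple (tnth t i + a i)%R | i < n.+1]).
  apply/measurable_fun_tnthP => i.
  rewrite (_ : _ \o _ = fun t : n.+1.-tuple R => tnth t i + a i).
    by apply: measurable_funD => //; exact: measurable_tnth.
  by apply/funext => t /=; rewrite tnth_mktuple.
rewrite integral_lebesgue_tupleS//; last first.
  exact: (measurableT_comp mF ma).
rewrite [RHS]integral_lebesgue_tupleS//.
have mc : measurable_fun setT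
    (fun x : measurableTypeR R * n.-tuple R => [tuple of x.1 :: x.2] : n.+1.-tuple R).
  exact: measurable_cons.
rewrite -[RHS](@integral_lebesgue_shift _ _ (a 0%N)); last 2 first.
- exact: (measurable_fun_fubini_tonelli_F
    (fun x : measurableTypeR R * n.-tuple R => F [tuple of x.1 :: x.2])
    (measurableT_comp mF mc)).
- by move=> x; exact: integral_ge0.
apply: eq_integral => x _.
rewrite -[RHS](IH (fun i => a i.+1)); last 2 first.
- by apply: (measurableT_comp mF); exact: measurable_cons.
- by [].
apply: eq_integral => t _; congr F; apply: eq_from_tnth => i.
rewrite tnth_mktuple; case: (unliftP ord0 i) => [j|] ->.
  by rewrite !tnthS tnth_mktuple.
by rewrite !tnth0.
Qed.

Lemma measurable_tcast_cat (N m n : nat) (e : (m + n)%N = N) :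
  measurable_fun setT (fun p : m.-tuple R * n.-tuple R => tcast e [tuple of p.1 ++ p.2]).
Proof.
apply/measurable_fun_tnthP => i.
have [im|im] := ltnP i m.
  rewrite (_ : _ \o _ = fun p : m.-tuple R * n.-tuple R => tnth p.1 (Ordinal im)).
    exact: (measurableT_comp (measurable_tnth _) measurable_fst).
  apply/funext => p /=; rewrite !(tnth_nth 0) val_tcast nth_cat size_tuple im.
  by rewrite -tnth_nth.
have inm : (i - m < n)%N by rewrite ltn_subLR// e.
rewrite (_ : _ \o _ = fun p : m.-tuple R * n.-tuple R => tnth p.2 (Ordinal inm)).
  exact: (measurableT_comp (measurable_tnth _) measurable_snd).
apply/funext => p /=; rewrite !(tnth_nth 0) val_tcast nth_cat size_tuple.
by rewrite ltnNge im.
Qed.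

(** The length N is kept apart from m + n because triangular numbers satisfy the required sum only
    up to a proved equation. *)
Lemma integral_lebesgue_tuple_cat (N m n : nat) (e : (m + n)%N = N)
    (F : N.-tuple R -> \bar R) :
  measurable_fun setT F -> (forall t, 0 <= F t)%E ->
  (\int[lebesgue_tuple N]_t F t =
   \int[lebesgue_tuple m]_s \int[lebesgue_tuple n]_t F (tcast e [tuple of s ++ t]))%E.
Proof.
case: N / e F; elim: m => [|m IH] F mF F0.
  rewrite integral_lebesgue_tuple0; apply: eq_integral => t _.
  by congr F; apply: val_inj.
have mc : measurable_fun setT
    (fun x : measurableTypeR R * (m + n).-tuple R =>
      [tuple of x.1 :: x.2] : (m + n).+1.-tuple R).
  exact: measurable_cons.
rewrite [LHS](@integral_lebesgue_tupleS (m + n) F)// [RHS]integral_lebesgue_tupleS; last 2 first.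
- exact: (measurable_fun_fubini_tonelli_F
    (fun p : m.+1.-tuple R * n.-tuple R => F (tcast erefl [tuple of p.1 ++ p.2]))
    (measurableT_comp mF (@measurable_tcast_cat _ _ _ erefl))).
- by move=> t; exact: integral_ge0.
apply: eq_integral => x _; rewrite IH//; last first.
  by apply: (measurableT_comp mF); exact: measurable_cons.
apply: eq_integral => s _; apply: eq_integral => t _; congr F.
by apply: val_inj.
Qed.

End lebesgue_tuple_theory.

Lemma triangleS (j : nat) : ((j.+1 * j.+2)./2 = (j * j.+1)./2 + j.+1)%N.
Proof.
have -> : (j.+1 * j.+2 = (j.+1).*2 + j * j.+1)%N by rewrite -muln2; ring.
by rewrite halfD odd_double doubleK add0n addnC.
Qed.

Lemma triangle_le (j k : nat) : (j <= k)%N -> ((j * j.+1)./2 <= (k * k.+1)./2)%N.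
Proof. by move=> jk; apply: half_leq; rewrite leq_mul. Qed.

Lemma triangle_lt (i j n : nat) : (i <= j)%N -> (j < n)%N ->
  ((j * j.+1)./2 + i < (n * n.+1)./2)%N.
Proof.
move=> ij jn; apply: leq_trans (triangle_le jn).
by rewrite triangleS ltn_add2l ltnS.
Qed.

(** Column j fills the positions from j (j + 1) / 2 to j (j + 1) / 2 + j, and the next column starts
    right after. *)
Lemma triangle_inj (i j i' j' : nat) : (i <= j)%N -> (i' <= j')%N ->
  ((j * j.+1)./2 + i = (j' * j'.+1)./2 + i')%N -> i = i' /\ j = j'.
Proof.
move=> ij ij' e; have [jj|jj|jj] := ltngtP j j'.
- by have := triangle_lt ij jj; rewrite e ltnNge leq_addr.
- by have := triangle_lt ij' jj; rewrite -e ltnNge leq_addr.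
- by move: e; rewrite jj => /addnI.
Qed.

Section lebesgue_sym_theory.
Context {R : realType}.
Notation leb := (@lebesgue_measure R).

Lemma integral_lebesgue_sym (n : nat) (f : 'M[R]_n -> \bar R) :
  measurable_fun setT f -> (forall X, 0 <= f X)%E ->
  (\int[lebesgue_sym n]_X f X = \int[lebesgue_tuple (n * n.+1)./2]_t f (sym_mx t))%E.
Proof.
by move=> mf f0; rewrite /lebesgue_sym (ge0_integral_pushforward (@measurable_sym_mx R n))//.
Qed.

Lemma trmx_sym_mx (n : nat) (t : (n * n.+1)./2.-tuple R) : (sym_mx t)^T = sym_mx t.
Proof. by apply/matrixP => i j; rewrite !mxE maxnC minnC. Qed.

Lemma sym_mx_shift (n : nat) (Y : 'M[R]_n) : Y^T = Y -> exists a : nat -> R,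
  forall t, sym_mx (d:=n) [tuple tnth t i + a i | i < (n * n.+1)./2] = sym_mx t + Y.
Proof.
move=> sY.
(* The entry of Y stored at position k; [triangle_inj] makes the pair that is picked unique. *)
pose a k := if [pick p : 'I_n * 'I_n | (p.1 <= p.2)%N &&
  ((p.2 * p.2.+1)./2 + p.1 == k)%N] is Some p then Y p.1 p.2 else 0.
have aE (i j : 'I_n) : (i <= j)%N -> a ((j * j.+1)./2 + i)%N = Y i j.
  move=> ij; rewrite /a; case: pickP => [p /andP[p12 /eqP e]|/(_ (i, j))]; last first.
    by rewrite /= ij eqxx.
  by have [/val_inj -> /val_inj ->] := triangle_inj p12 ij e.
exists a => t; apply/matrixP => i j; rewrite !mxE.
wlog ij : i j / (i <= j)%N.
  move=> H; have /orP[ij|ji] := leq_total i j; first exact: H.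
  rewrite maxnC minnC (H _ _ ji); congr (_ + _).
  by rewrite -{1}sY mxE.
rewrite (maxn_idPr ij) (minn_idPl ij).
have k_lt := triangle_lt ij (ltn_ord j).
rewrite -(tnth_nth 0 _ (Ordinal k_lt)) tnth_mktuple (tnth_nth 0) /=.
by rewrite aE.
Qed.

Lemma integral_lebesgue_sym_shift (n : nat) (Y : 'M[R]_n) (f : 'M[R]_n -> \bar R) :
  Y^T = Y -> measurable_fun setT f -> (forall X, 0 <= f X)%E ->
  (\int[lebesgue_sym n]_X f (X + Y)%R = \int[lebesgue_sym n]_X f X)%E.
Proof.
move=> /sym_mx_shift[a aE] mf f0.
have mY : measurable_fun setT (fun X : 'M[R]_n => X + Y).
  apply/measurable_fun_mxP => i j; under eq_fun do rewrite mxE.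
  by rewrite -/(measurable_fun _ _); mfun; exact: measurable_entry.
rewrite integral_lebesgue_sym//; last exact: (measurableT_comp mf mY).
under eq_integral do rewrite -aE.
rewrite integral_lebesgue_sym// -[RHS](integral_lebesgue_tuple_shift a)//.
exact: (measurableT_comp mf (@measurable_sym_mx R n)).
Qed.

(** In column order the coordinates of the leading block come first and the last column (v, z)
    follows. The trivial cast along [e1] matches the one left by a second use of
    [integral_lebesgue_tuple_cat]. *)
Lemma sym_mx_cat (n : nat) (e : ((n * n.+1)./2 + (n + 1))%N = ((n + 1) * (n + 1).+1)./2)
    (s : (n * n.+1)./2.-tuple R) (v : n.-tuple R) (z : R) (e1 : (n + 1)%N = (n + 1)%N) :
  sym_mx (d:=n + 1) (tcast e [tuple of s ++ tcast e1 [tuple of v ++ [tuple z]]]) =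
  bordered_mx (sym_mx s) (\row_j tnth v j) z.
Proof.
apply/matrixP => i j; rewrite mxE.
rewrite !val_tcast /= !val_tcast /=.
have nthv (k : 'I_n) : (v ++ [:: z])`_k = tnth v k.
  by rewrite nth_cat size_tuple ltn_ord (tnth_nth 0).
have nths k : (s ++ v ++ [:: z])`_((n * n.+1)./2 + k) = (v ++ [:: z])`_k.
  by rewrite nth_cat size_tuple ltnNge leq_addr /= addKn.
case: (splitP i) => i' ii; case: (splitP j) => j' jj.
- have -> : i = lshift 1 i' by exact: val_inj.
  have -> : j = lshift 1 j' by exact: val_inj.
  rewrite /bordered_mx block_mxEul mxE /= nth_cat size_tuple triangle_lt//.
    by rewrite (leq_trans (geq_minl _ _)) ?leq_maxl.
  by rewrite gtn_max !ltn_ord.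
- have -> : i = lshift 1 i' by exact: val_inj.
  have -> : j = rshift n j' by exact: val_inj.
  rewrite /bordered_mx block_mxEur !mxE /= ord1 addn0.
  by rewrite (maxn_idPr (ltnW (ltn_ord _))) (minn_idPl (ltnW (ltn_ord _))) nths nthv.
- have -> : i = rshift n i' by exact: val_inj.
  have -> : j = lshift 1 j' by exact: val_inj.
  rewrite /bordered_mx block_mxEdl !mxE /= ord1 addn0.
  by rewrite (maxn_idPl (ltnW (ltn_ord _))) (minn_idPr (ltnW (ltn_ord _))) nths nthv.
- have -> : i = rshift n i' by exact: val_inj.
  have -> : j = rshift n j' by exact: val_inj.
  rewrite /bordered_mx block_mxEdr !mxE /= !ord1 addn0 maxnn minnn nths.
  by rewrite nth_cat size_tuple ltnn subnn.
Qed.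

End lebesgue_sym_theory.

(** * The multivariate gamma function *)

Section multivariate_gamma.
Context {R : realType}.
Notation leb := (@lebesgue_measure R).

Lemma measurable_bordered_mx (n : nat) (v : 'rV[R]_n) (z : R) :
  measurable_fun setT (fun Y => bordered_mx Y v z).
Proof.
apply/measurable_fun_mxP => i j; rewrite /bordered_mx.
case: (split_ordP i) => i' ->; case: (split_ordP j) => j' ->.
- by under eq_fun do rewrite block_mxEul; exact: measurable_entry.
- by under eq_fun do rewrite block_mxEur; exact: measurable_cst.
- by under eq_fun do rewrite block_mxEdl; exact: measurable_cst.
- by under eq_fun do rewrite block_mxEdr; exact: measurable_cst.
Qed.

(** The leading block is integrated innermost, so that it can be translated by an amount depending
    on v and z. *)
Lemma integral_lebesgue_sym_bordered (n : nat) (f : 'M[R]_(n + 1) -> \bar R) :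
  measurable_fun setT f -> (forall X, 0 <= f X)%E ->
  (\int[lebesgue_sym (n + 1)]_X f X =
   \int[lebesgue_tuple n]_v \int[leb]_z \int[lebesgue_sym n]_Y
     f (bordered_mx Y (\row_j tnth v j) z))%E.
Proof.
move=> mf f0.
have e : ((n * n.+1)./2 + (n + 1))%N = ((n + 1) * (n + 1).+1)./2.
  by rewrite addn1 triangleS.
have ms := measurableT_comp mf (@measurable_sym_mx R (n + 1)).
have mF := measurableT_comp ms (measurable_tcast_cat e).
have F0 p : (0 <= ((f \o sym_mx (d:=n + 1)) \o (fun p : _.-tuple R * _.-tuple R =>
    tcast e [tuple of p.1 ++ p.2])) p)%E by exact: f0.
rewrite integral_lebesgue_sym// (integral_lebesgue_tuple_cat e)//.
rewrite (fubini_tonelli _ mF F0).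
rewrite (integral_lebesgue_tuple_cat (erefl (n + 1)%N)); last 2 first.
- exact: (measurable_fun_fubini_tonelli_G _ mF F0).
- by move=> u; apply: integral_ge0 => s _; exact: f0.
apply: eq_integral => v _.
rewrite integral_lebesgue_tupleS; last 2 first.
- apply: measurableT_comp (measurable_fun_fubini_tonelli_G _ mF F0) _.
  exact: (measurable_fun_pair2 _ (measurable_tcast_cat erefl)).
- by move=> u; apply: integral_ge0 => s _; exact: f0.
apply: eq_integral => z _; rewrite integral_lebesgue_tuple0.
rewrite integral_lebesgue_sym; last 2 first.
- exact: (measurableT_comp mf (measurable_bordered_mx _ _)).
- by move=> Y; exact: f0.
apply: eq_integral => s _; rewrite -(sym_mx_cat e _ _ _ erefl) /=.
by congr (f (sym_mx (tcast _ _))); apply: val_inj.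
Qed.

Lemma integral_gauss_tuple (n : nat) (z : R) : 0 < z ->
  (\int[lebesgue_tuple n]_v (expR (- (\sum_i tnth v i ^+ 2 / z)))%:E =
   (Num.sqrt (pi * z) ^+ n)%:E)%E.
Proof.
move=> z0; elim: n => [|n IH].
  by rewrite integral_lebesgue_tuple0 big_ord0 oppr0 expR0 expr0.
have mS k : measurable_fun setT (fun v : k.-tuple R =>
    (expR (- (\sum_i tnth v i ^+ 2 / z)))%:E).
  mfun; apply: measurable_sum => i; mfun.
  exact: measurable_tnth.
rewrite integral_lebesgue_tupleS//.
transitivity (\int[leb]_x ((Num.sqrt (pi * z) ^+ n)%:E * (expR (- (x ^+ 2 / z)))%:E))%E.
  apply: eq_integral => x _; rewrite -IH muleC -ge0_integralZl_EFin ?expR_ge0//; last exact: mS.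
  apply: eq_integral => v _; rewrite -EFinM -expRD big_ord_recl tnth0 opprD.
  by congr (expR (_ - _))%:E; apply: eq_bigr => i _; rewrite tnthS.
rewrite ge0_integralZl_EFin ?exprn_ge0 ?sqrtr_ge0//; last by mfun.
by rewrite integral_gauss// -EFinM exprSr.
Qed.

Variable p : R.

(** The integrand of the multivariate gamma function. The exponent p stays fixed while the size n
    varies, as the induction on n requires. *)
Definition mgamma_density (n : nat) (X : 'M[R]_n) : R :=
  \1_(pos_definite n) X * (expR (- \tr X) * \det X `^ p).

Lemma mgamma_density_ge0 (n : nat) (X : 'M[R]_n) : 0 <= mgamma_density X.
Proof. by rewrite !mulr_ge0 ?expR_ge0 ?powR_ge0. Qed.

Lemma measurable_mgamma_density (n : nat) :
  measurable_fun setT (@mgamma_density n).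
Proof.
rewrite /mgamma_density; mfun.
- exact: (measurable_indic (@measurable_pos_definite R n)).
- exact: measurable_mxtrace.
- exact: measurable_det.
Qed.

Let mgamma n := (\int[lebesgue_sym n]_X (@mgamma_density n X)%:E)%E.

(** The kernel factors because the bordered matrix has determinant |W| z and trace tr W + |v|^2 / z
    + z. *)
Let bordered_density (n : nat) (v : n.-tuple R) (z : R) (W : 'M[R]_n) : 0 < z ->
  mgamma_density (bordered_mx (W + z^-1 *:
      ((\row_j tnth v j)^T *m (\row_j tnth v j))) (\row_j tnth v j) z) =
  expR (- (\sum_i tnth v i ^+ 2 / z)) * (expR (- z) * z `^ p) * mgamma_density W.
Proof.
move=> z0; rewrite /mgamma_density tr_bordered det_bordered ?gt_eqF// mxtraceD mxtraceZ.
have -> : \tr ((\row_j tnth v j)^T *m (\row_j tnth v j)) = \sum_i tnth v i ^+ 2.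
  rewrite mxtrace_mulC /mxtrace big_ord1 mxE; apply: eq_bigr => i _.
  by rewrite !mxE expr2.
have pW := pos_definite_bordered W (\row_j tnth v j) (lt0r_neq0 z0).
rewrite !indicE; case: (boolP (W \in pos_definite n)) => hW; last first.
  rewrite memNset ?mul0r ?mulr0// => /pW[+ _].
  by move: hW; rewrite notin_setE.
have {}hW : pos_definite n W by move: hW; rewrite inE.
rewrite mem_set; last exact/pW.
rewrite !mul1r powRM ?(ltW z0) ?(ltW (pos_definite_det hW))//.
rewrite !opprD !expRD -mulr_suml (mulrC z^-1); ring.
Qed.

(* Translate [Y] by [z^-1 v^T v] to clear the off-diagonal block; what remains
   is a Gaussian integral in [v] and a gamma integral in [z]. *)
Lemma mgammaS (n : nat) : - 1 < p ->
  (mgamma (n + 1) =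
   (Num.sqrt pi ^+ n * gamma_fun (p + n%:R / 2 + 1))%:E * mgamma n)%E.
Proof.
move=> p1.
have mg0 : (0 <= mgamma n)%E.
  by apply: integral_ge0 => X _; rewrite lee_fin mgamma_density_ge0.
rewrite /mgamma integral_lebesgue_sym_bordered; last 2 first.
- by apply/measurable_EFinP; exact: measurable_mgamma_density.
- by move=> X; rewrite lee_fin mgamma_density_ge0.
rewrite -/(mgamma n).
pose K (q : n.-tuple R * measurableTypeR R) : \bar R :=
  ((\1_`]0%R, +oo[ q.2 * (expR (- (\sum_i tnth q.1 i ^+ 2 / q.2)) *
    (expR (- q.2) * q.2 `^ p)))%:E * mgamma n)%E.
transitivity (\int[lebesgue_tuple n]_v \int[leb]_z K (v, z))%E.
  apply: eq_integral => v _; apply: eq_integral => z _.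
  rewrite /K indicE /=; case: (boolP (z \in _)) => zin; last first.
    rewrite mul0r mul0e integral0_eq// => Y _; rewrite /mgamma_density indicE.
    rewrite memNset ?mul0r// => /pos_definite_pivot.
    rewrite /border_pivot /bordered_mx block_mxKdr mxE mulr1n => z0.
    by move: zin; rewrite notin_setE/= in_itv/= andbT z0.
  have z0 : 0 < z by move: zin; rewrite inE/= in_itv/= andbT.
  set w := \row_j tnth v j.
  have sw : (z^-1 *: (w^T *m w))^T = z^-1 *: (w^T *m w).
    by rewrite linearZ/= trmx_mul trmxK.
  rewrite -(integral_lebesgue_sym_shift (f:=fun Y => (mgamma_density (bordered_mx Y w z))%:E) sw);
    last 2 first.
  - apply/measurable_EFinP.
    exact: (measurableT_comp (@measurable_mgamma_density _) (measurable_bordered_mx _ _)).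
  - by move=> Y; rewrite lee_fin mgamma_density_ge0.
  under eq_integral do rewrite bordered_density// EFinM.
  rewrite ge0_integralZl_EFin ?mul1r//.
  - by move=> X _; rewrite lee_fin mgamma_density_ge0.
  - by apply/measurable_EFinP; exact: measurable_mgamma_density.
  - by rewrite !mulr_ge0 ?expR_ge0 ?powR_ge0.
have mK : measurable_fun setT K.
  have m2 : measurable_fun setT (fun q : n.-tuple R * measurableTypeR R => q.2).
    exact: measurable_snd.
  rewrite /K; mfun.
  - exact: (measurableT_comp (measurable_indic (measurable_itv _))).
  - apply: measurable_sum => i; mfun.
    exact: (measurableT_comp (measurable_tnth _) measurable_fst).
have K0 q : (0 <= K q)%E.
  by rewrite mule_ge0// lee_fin !mulr_ge0 ?expR_ge0 ?powR_ge0.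
rewrite (fubini_tonelli K mK K0).
have a0 : 0 < p + n%:R / 2 + 1.
  have : 0 <= n%:R / 2 :> R by rewrite divr_ge0.
  by move: p1; lra.
pose C := ((Num.sqrt pi ^+ n)%:E * mgamma n)%E.
(* The Gaussian factor sqrt (pi z)^n raises the power z^p to z^(p + n/2), whence the gamma parameter
   p + n/2 + 1. *)
transitivity (\int[leb]_(z in `]0%R, +oo[)
    (C * (z `^ (p + n%:R / 2 + 1 - 1) * expR (- z))%:E))%E.
  rewrite [RHS]integral_mkcond; apply: eq_integral => z _.
  pose c := (\1_`]0%R, +oo[ z * (expR (- z) * z `^ p)) : R.
  have Kz v : K (v, z) = (c%:E * mgamma n * (expR (- (\sum_i tnth v i ^+ 2 / z)))%:E)%E.
    by rewrite /K /c muleAC -EFinM; congr (_%:E * _)%E => /=; ring.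
  under eq_integral do rewrite Kz.
  have c0 : (0 <= c%:E * mgamma n)%E.
    by rewrite mule_ge0// lee_fin !mulr_ge0 ?expR_ge0 ?powR_ge0.
  rewrite ge0_integralZl//; last first.
    mfun; apply: measurable_sum => i; mfun.
    exact: measurable_tnth.
  rewrite /patch /c indicE; case: ifPn => zin; last by rewrite mul0r !mul0e.
  have z0 : 0 < z by move: zin; rewrite inE/= in_itv/= andbT.
  rewrite integral_gauss_tuple// mul1r muleAC -EFinM /C muleAC -EFinM.
  congr (_%:E * _)%E; rewrite sqrtrM ?pi_ge0// exprMn mulrC -mulrA; congr (_ * _).
  rewrite -(powR12_sqrt (ltW z0)) -powR_mulrn ?powR_ge0// -powRrM.
  rewrite addrK powRD; last by rewrite (gt_eqF z0) implybT.
  by rewrite (mulrC 2^-1); ring.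
rewrite ge0_integralZl//; last 3 first.
- by apply: measurable_funTS; mfun.
- by move=> z _; rewrite lee_fin mulr_ge0 ?powR_ge0 ?expR_ge0.
- by rewrite mule_ge0// lee_fin exprn_ge0// sqrtr_ge0.
by rewrite gamma_funE// /C muleAC -EFinM.
Qed.

(** Since p > -1, all gamma factors p + n/2 + 1 met in the recursion are positive; at size 0 the
    integral is the value 1 at the only point. *)
Lemma mgamma_pos (n : nat) : - 1 < p -> exists2 c : R, 0 < c & mgamma n = c%:E.
Proof.
move=> p1; elim: n => [|n [c c0 nE]].
  exists 1; first by [].
  rewrite /mgamma integral_lebesgue_sym; last 2 first.
  - by apply/measurable_EFinP; exact: measurable_mgamma_density.
  - by move=> X; rewrite lee_fin mgamma_density_ge0.
  rewrite integral_lebesgue_tuple0 /mgamma_density indicE mem_set; last exact: pos_definite0.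
  by rewrite mul1r det_mx00 powR1 mulr1 /mxtrace big_ord0 oppr0 expR0.
exists (Num.sqrt pi ^+ n * gamma_fun (p + n%:R / 2 + 1) * c).
  rewrite !mulr_gt0// ?exprn_gt0 ?sqrtr_gt0 ?pi_gt0// gamma_fun_gt0//.
  have : 0 <= n%:R / 2 :> R by rewrite divr_ge0.
  by move: p1; lra.
by rewrite -addn1 mgammaS// nE.
Qed.

End multivariate_gamma.

(** * Invariance under orthogonal conjugation *)

Section orthogonal_invariance.
Context {R : realType} (n : nat).
Notation conj O X := (O *m X *m O^T).
Notation lint f := (\int[lebesgue_sym n]_X f X)%E.
Notation tup := ((n * n.+1)./2.-tuple R).
Implicit Types (O X : 'M[R]_n) (f h : 'M[R]_n -> \bar R).

Lemma measurable_mx_conj O : measurable_fun setT (fun X => conj O X).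
Proof.
apply/measurable_fun_mxP => i j; under eq_fun do rewrite mxE.
apply: measurable_sum => k; rewrite -/(measurable_fun _ _); mfun.
under eq_fun do rewrite mxE; apply: measurable_sum => l; rewrite -/(measurable_fun _ _).
by mfun; exact: measurable_entry.
Qed.

Lemma measurable_mxD d (T : measurableType d) (F G : T -> 'M[R]_n) :
  measurable_fun setT F -> measurable_fun setT G ->
  measurable_fun setT (fun x => F x + G x).
Proof.
move=> /measurable_fun_mxP mF /measurable_fun_mxP mG.
by apply/measurable_fun_mxP => i j; under eq_fun do rewrite mxE; apply: measurable_funD.
Qed.

Lemma measurable_mxN : measurable_fun setT (fun X : 'M[R]_n => - X).
Proof.
apply/measurable_fun_mxP => i j; under eq_fun do rewrite mxE.
by rewrite -/(measurable_fun _ _); mfun; exact: measurable_entry.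
Qed.

Let lintE f : measurable_fun setT f -> (forall X, 0 <= f X)%E ->
  lint f = (\int[lebesgue_tuple (n * n.+1)./2]_t f (sym_mx (t : tup)))%E.
Proof. exact: integral_lebesgue_sym. Qed.

Variable O : 'M[R]_n.
Hypothesis OO : O *m O^T = 1%:M.

Let conjK X : conj O (conj O^T X) = X.
Proof. by rewrite trmxK !mulmxA OO mul1mx -mulmxA OO mulmx1. Qed.

Let conj_sym (A X : 'M[R]_n) : X^T = X -> (A *m X *m A^T)^T = A *m X *m A^T.
Proof. by move=> sX; rewrite !trmx_mul trmxK sX mulmxA. Qed.

Let conjD X Y : conj O (X + Y) = conj O X + conj O Y.
Proof. by rewrite mulmxDr mulmxDl. Qed.

(* Uniqueness of the Haar measure: the pushforward of Lebesgue measure by a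
   linear automorphism is translation invariant, and Tonelli's theorem applied
   to [f (c s + t) * h t] after the substitutions [s -> s - c^-1 t] and
   [t -> t - c s] separates the two factors. *)
Lemma integral_conj_exchange f h :
  measurable_fun setT f -> (forall X, 0 <= f X)%E ->
  measurable_fun setT h -> (forall X, 0 <= h X)%E ->
  (lint (fun X => f (conj O X)%R) * lint h = lint f * lint (fun X => h (- (conj O X))%R))%E.
Proof.
move=> mf f0 mh h0.
have ms : measurable_fun setT (fun t : tup => sym_mx t) by exact: measurable_sym_mx.
have mc := measurable_mx_conj O.
have mfst : measurable_fun setT (fun p : tup * tup => sym_mx p.1).
  exact: (measurableT_comp ms measurable_fst).
have msnd : measurable_fun setT (fun p : tup * tup => sym_mx p.2).
  exact: (measurableT_comp ms measurable_snd).
have mfc : measurable_fun setT (fun X => f (conj O X)) by exact: measurableT_comp.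
have mhc : measurable_fun setT (fun X => h (- (conj O X))).
  exact: (measurableT_comp mh (measurableT_comp measurable_mxN mc)).
have lint0 g : (forall X, 0 <= g X)%E -> (0 <= lint g)%E.
  by move=> g0; apply: integral_ge0.
have mD X : measurable_fun setT (fun Y : 'M[R]_n => Y + X).
  by apply: measurable_mxD => //; exact: measurable_cst.
have mN X : measurable_fun setT (fun Y : 'M[R]_n => X - Y).
  by apply: measurable_mxD; [exact: measurable_cst|exact: measurable_mxN].
(* Tonelli's theorem is applied on the coordinate tuples, whose Lebesgue measure is available as a
   sigma-finite one. *)
pose F (p : tup * tup) : \bar R :=
  (f (conj O (sym_mx p.1) + sym_mx p.2)%R * h (sym_mx p.2))%E.
pose G (p : tup * tup) : \bar R :=
  (f (sym_mx p.2) * h (sym_mx p.2 - conj O (sym_mx p.1))%R)%E.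
have F0 p : (0 <= F p)%E by rewrite mule_ge0.
have G0 p : (0 <= G p)%E by rewrite mule_ge0.
have mcf : measurable_fun setT (fun p : tup * tup => conj O (sym_mx p.1)).
  exact: (measurableT_comp mc mfst).
have mF : measurable_fun setT F.
  apply: emeasurable_funM; last exact: (measurableT_comp mh msnd).
  exact: (measurableT_comp mf (measurable_mxD mcf msnd)).
have mG : measurable_fun setT G.
  apply: emeasurable_funM; first exact: (measurableT_comp mf msnd).
  apply: (measurableT_comp mh); apply: (measurable_mxD msnd).
  exact: (measurableT_comp measurable_mxN mcf).
transitivity (\int[lebesgue_tuple _]_t \int[lebesgue_tuple _]_s F (s, t))%E.
  rewrite (lintE mh h0) -ge0_integralZl//; last 2 first.
  - exact: (measurableT_comp mh ms).
  - by apply: lint0.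
  apply: eq_integral => t _.
  (* S is the preimage of t under conjugation: translating X by S adds t to O X O^T. *)
  pose S := conj O^T (sym_mx t).
  have sS : S^T = S by apply: conj_sym; exact: trmx_sym_mx.
  rewrite -(integral_lebesgue_sym_shift (f:=fun X => f (conj O X)) sS)//.
  rewrite lintE//; last exact: (measurableT_comp mfc (mD S)).
  rewrite -ge0_integralZr//.
  - by apply: eq_integral => s _; rewrite /F /= conjD /S conjK.
  - exact: (measurableT_comp (measurableT_comp mfc (mD S)) ms).
rewrite -(fubini_tonelli F mF F0).
transitivity (\int[lebesgue_tuple _]_s \int[lebesgue_tuple _]_t G (s, t))%E.
  apply: eq_integral => s _.
  pose S := conj O (sym_mx s).
  have sS : S^T = S by apply: conj_sym; exact: trmx_sym_mx.
  pose k X := (f X * h (X - S)%R)%E.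
  have mk : measurable_fun setT k.
    by apply: emeasurable_funM => //; exact: (measurableT_comp mh (mD (- S))).
  have k0 X : (0 <= k X)%E by rewrite mule_ge0.
  have := integral_lebesgue_sym_shift sS mk k0.
  rewrite !lintE//; last exact: (measurableT_comp mk (mD S)).
  rewrite /k /G /F /= => <-; apply: eq_integral => t _.
  by rewrite addrK addrC.
rewrite (fubini_tonelli G mG G0) (lintE mf f0) -ge0_integralZr//; last 2 first.
- exact: (measurableT_comp mf ms).
- by apply: integral_ge0 => X _; exact: h0.
apply: eq_integral => t _.
(* With the same S the translation cancels t and leaves h at - O X O^T. *)
pose S := conj O^T (sym_mx t).
have sS : S^T = S by apply: conj_sym; exact: trmx_sym_mx.
pose k X := h (sym_mx t - conj O X)%R.
have mk : measurable_fun setT k.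
  exact: (measurableT_comp mh (measurableT_comp (mN (sym_mx t)) mc)).
have k0 X : (0 <= k X)%E by exact: h0.
rewrite /G /= ge0_integralZl//; last first.
  exact: (measurableT_comp mk ms).
congr (_ * _)%E.
rewrite -[LHS](lintE mk k0) -(integral_lebesgue_sym_shift sS mk k0).
apply: eq_integral => X _; rewrite /k conjD /S conjK; congr h.
by rewrite opprD addrCA subrr addr0.
Qed.

End orthogonal_invariance.

Section orthogonal_invariance_theorem.
Context {R : realType} (n : nat).
Implicit Types (O X : 'M[R]_n) (h : 'M[R]_n -> \bar R).

Lemma unitmx_orthogonal O : O *m O^T = 1%:M -> O \in unitmx.
Proof. by move=> /mulmx1_unit[]. Qed.

Lemma mgamma_density_conj (p : R) O X : O *m O^T = 1%:M ->
  mgamma_density p (O *m X *m O^T) = mgamma_density p X.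
Proof.
move=> OO; rewrite /mgamma_density mxtrace_mulC mulmxA (mulmx1C OO) mul1mx.
rewrite !det_mulmx det_tr mulrAC -[X in X * _]mulr1.
have -> : \det O * \det O = 1 by rewrite -{2}det_tr -det_mulmx OO det1.
rewrite mulr1 mul1r; congr (_ * _); rewrite !indicE; congr (nat_of_bool _)%:R.
by apply: asbool_equiv_eq; exact: pos_definite_congr (unitmx_orthogonal OO).
Qed.

(* [mgamma_density 0] is invariant and has a finite nonzero integral, so it
   shows that the Haar factor is 1. *)
Lemma integral_lebesgue_sym_conj O h : O *m O^T = 1%:M ->
  measurable_fun setT h -> (forall X, 0 <= h X)%E ->
  (\int[lebesgue_sym n]_X h (O *m X *m O^T) = \int[lebesgue_sym n]_X h X)%E.
Proof.
move=> OO mh h0.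
pose f X : \bar R := (@mgamma_density R 0 n X)%:E.
have mf : measurable_fun setT f by apply/measurable_EFinP; exact: measurable_mgamma_density.
have f0 X : (0 <= f X)%E by rewrite lee_fin mgamma_density_ge0.
have [c c0 fc] : exists2 c : R, 0 < c & (\int[lebesgue_sym n]_X f X = c%:E)%E.
  by apply: mgamma_pos; lra.
have key A g : A *m A^T = 1%:M -> measurable_fun setT g -> (forall X, 0 <= g X)%E ->
    (\int[lebesgue_sym n]_X g X = \int[lebesgue_sym n]_X g (- (A *m X *m A^T))%R)%E.
  move=> AA mg g0; have := integral_conj_exchange AA mf f0 mg g0.
  rewrite (_ : (fun X => f _) = f) ?fc; last first.
    by apply/funext => X; rewrite /f /= mgamma_density_conj.
  move=> /(congr1 (fun u => (c^-1)%:E * u)%E); rewrite !muleA -!EFinM.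
  by rewrite mulVf ?gt_eqF// !mul1e.
(* The case A = I of [key] removes the sign that the case A = O leaves. *)
have I1 : (1%:M : 'M[R]_n) *m 1%:M^T = 1%:M by rewrite trmx1 mulmx1.
rewrite (key 1%:M (fun X => h (O *m X *m O^T)))//; last first.
  exact: (measurableT_comp mh (measurable_mx_conj O)).
rewrite [RHS](key O)//; apply: eq_integral => X _; congr h.
by rewrite trmx1 mul1mx mulmx1 mulmxN mulNmx.
Qed.

End orthogonal_invariance_theorem.

(** * The Laplace exponent *)

Lemma pos_definite_tr {R : realType} (n : nat) (X : 'M[R]_n) : (0 < n)%N ->
  pos_definite n X -> 0 < \tr X.
Proof.
move=> n0 [sX pX].
have diag i : 0 < X i i.
  have := pX (delta_mx 0 i); rewrite -rowE trmx_delta -colE !mxE; apply.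
  by apply/eqP => /matrixP /(_ 0 i) /eqP; rewrite !mxE !eqxx oner_eq0.
rewrite /mxtrace (bigD1 (Ordinal n0))//= ltr_pwDl// sumr_ge0// => i _.
exact: ltW.
Qed.

Lemma pos_definiteZ {R : realType} (n : nat) (r : R) (X : 'M[R]_n) : 0 < r ->
  pos_definite n (r *: X) <-> pos_definite n X.
Proof.
move=> r0.
have sc (s : R) (Y : 'M[R]_n) : 0 < s -> pos_definite n Y -> pos_definite n (s *: Y).
  move=> s0 [sY pY]; split; first by rewrite linearZ/= sY.
  by move=> v /pY h; rewrite -scalemxAr -scalemxAl mxE mulr_gt0.
split; last exact: sc.
by move=> /(sc r^-1); rewrite invr_gt0 scalerA mulVf ?gt_eqF// scale1r; apply.
Qed.

Section matrix_gamma_exponent.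
Context {R : realType} (d : nat) (eta sigma : R) (omega : {posnum R}).
Variable dU : {measure set 'M[R]_d -> \bar R}.
Hypotheses (d0 : (1 <= d)%N) (etad : (d%:R - 1) / 2 < eta) (sigma0 : 0 < sigma).
Hypothesis dUP : is_spherical_measure dU.
Notation leb := (@lebesgue_measure R).
Notation p := (eta - d.+1%:R / 2).
Notation a := (eta * d%:R).
Notation S := (@trace_sphere R d).
Notation PD := (@pos_definite R d).

Let p1 : - 1 < p.
Proof. by move: etad; rewrite -(natr1 d); lra. Qed.

Let d1 : 1 <= d%:R :> R. Proof. by rewrite ler1n. Qed.

Let a0 : 0 < a.
Proof. by apply: mulr_gt0; move: etad d1; lra. Qed.

Let mD := @measurable_mgamma_density R p d.
Let mS := @measurable_trace_sphere R d.

Let mgamma_funP : 0 < mgamma_fun d eta /\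
  (\int[lebesgue_sym d]_X (@mgamma_density R p d X)%:E = (mgamma_fun d eta)%:E)%E.
Proof.
have [c c0 cE] := mgamma_pos d p1.
suff -> : mgamma_fun d eta = c by [].
rewrite /mgamma_fun integral_mkcond -[RHS]/(fine c%:E) -cE; congr fine.
apply: eq_integral => X _; rewrite /patch /mgamma_density indicE.
by case: ifPn => _; rewrite ?mul1r ?mul0r.
Qed.

(** The count of powers of r in polar coordinates: d p + d (d + 1) / 2 - 1 = eta d - 1. *)
Let exponentE (r : R) : 0 < r ->
  (r ^+ d) `^ p * expR (- r) * r ^+ ((d * d.+1)./2).-1 = r `^ (a - 1) * expR (- r).
Proof.
move=> r0; rewrite mulrAC; congr (_ * _).
rewrite -!powR_mulrn ?(ltW r0)// -powRrM -powRD; last by rewrite (gt_eqF r0) implybT.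
congr (_ `^ _).
have N1 : (0 < (d * d.+1)./2)%N by rewrite half_gt0; case: d d0.
have Ne : (d * d.+1)%:R = 2 * ((d * d.+1)./2)%:R :> R.
  rewrite -[in LHS](odd_double_half (d * d.+1)) oddM /= andbN add0n -muln2 natrM.
  by rewrite mulrC.
have := prednK N1 => /(congr1 (fun k => k%:R : R)); rewrite -(natr1 (_.-1)) => N2.
move: Ne; rewrite natrM -(natr1 d) => Ne; rewrite -N2 in Ne.
by lra.
Qed.

Lemma measurable_normalize : measurable_fun setT (fun X : 'M[R]_d => (\tr X)^-1 *: X).
Proof.
apply/measurable_fun_mxP => i j; under eq_fun do rewrite mxE.
rewrite -/(measurable_fun _ _); mfun; first exact: measurable_mxtrace.
exact: measurable_entry.
Qed.

(** At X = r U with tr U = 1 the function phi is evaluated at U alone, while the kernel becomes r^(d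
    p) e^(-r) |U|^p; the radial integral is therefore Gamma (eta d). *)
Lemma integral_polar (phi : 'M[R]_d -> \bar R) :
  measurable_fun setT phi -> (forall U, 0 <= phi U)%E ->
  (\int[lebesgue_sym d]_X ((mgamma_density p X)%:E * phi ((\tr X)^-1 *: X)) =
   (gamma_fun a)%:E * \int[dU]_(U in S) ((\det U `^ p)%:E * phi U))%E.
Proof.
move=> mphi phi0.
have mphi' := measurableT_comp mphi measurable_normalize.
have mf : measurable_fun setT (fun X : 'M[R]_d =>
    (mgamma_density p X)%:E * phi ((\tr X)^-1 *: X))%E.
  by apply: emeasurable_funM => //; exact/measurable_EFinP.
have f0 (X : 'M[R]_d) : (0 <= (mgamma_density p X)%:E * phi ((\tr X)^-1 *: X))%E.
  by rewrite mule_ge0// lee_fin mgamma_density_ge0.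
have [dU0 dUE] := dUP.
transitivity (\int[lebesgue_sym d]_(X in PD)
    ((mgamma_density p X)%:E * phi ((\tr X)^-1 *: X)))%E.
  rewrite [RHS]integral_mkcond; apply: eq_integral => X _; rewrite /patch.
  by case: ifPn => // hX; rewrite /mgamma_density indicE (negbTE hX) mul0r mul0e.
rewrite dUE//.
have mdetphi : measurable_fun setT (fun U : 'M[R]_d => (\det U `^ p)%:E * phi U)%E.
  by mfun; exact: measurable_det.
transitivity (\int[dU]_(U in S) ((gamma_fun a)%:E *
    ((\1_PD U)%:E * ((\det U `^ p)%:E * phi U))))%E.
  apply: eq_integral => U; rewrite inE => -[nU trU].
  transitivity (\int[leb]_(r in `]0%R, +oo[)
     (((\1_PD U)%:E * ((\det U `^ p)%:E * phi U)) *
        (r `^ (a - 1) * expR (- r))%:E))%E.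
    apply: eq_integral => r; rewrite inE/= in_itv/= andbT => r0.
    have trr : \tr (r *: U) = r by rewrite mxtraceZ trU mulr1.
    rewrite /mgamma_density trr scalerA mulVf ?gt_eqF// scale1r detZ.
    rewrite !indicE; case: (boolP (U \in PD)) => hU; last first.
      rewrite memNset ?mul0r ?mul0e//.
      by move=> /(pos_definiteZ _ r0); move: hU; rewrite notin_setE.
    have {}hU : PD U by move: hU; rewrite inE.
    rewrite mem_set; last exact/pos_definiteZ.
    rewrite !mul1r mul1e powRM ?exprn_ge0 ?(ltW r0) ?(ltW (pos_definite_det hU))//.
    rewrite -exponentE// muleAC -EFinM [RHS]muleAC -EFinM; congr (_%:E * _)%E; ring.
  rewrite ge0_integralZl//; last 3 first.
  - by apply: measurable_funTS; mfun.
  - by move=> r _; rewrite lee_fin mulr_ge0 ?powR_ge0 ?expR_ge0.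
  - by rewrite !mule_ge0// lee_fin ?powR_ge0.
  by rewrite gamma_funE// muleC.
have mI : measurable_fun setT (fun U : 'M[R]_d => (\1_PD U)%:E * ((\det U `^ p)%:E * phi U))%E.
  apply: emeasurable_funM => //; apply/measurable_EFinP.
  exact: (measurable_indic (@measurable_pos_definite R d)).
rewrite ge0_integralZl//; last 3 first.
- exact: measurable_funTS.
- by move=> U _; rewrite !mule_ge0// lee_fin ?powR_ge0.
- by rewrite lee_fin gamma_fun_ge0.
congr (_ * _)%E; apply: ge0_ae_eq_integral => //.
- exact: measurable_funTS.
- exact: measurable_funTS.
- by move=> U _; rewrite !mule_ge0// lee_fin ?powR_ge0.
- by move=> U _; rewrite mule_ge0// lee_fin powR_ge0.
- exists (~` (S `&` PD)); split => //.
    by apply: measurableC; apply: measurableI => //; exact: measurable_pos_definite.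
  move=> U /= h [SU pU]; apply: h => _.
  by rewrite indicE mem_set// mul1e.
Qed.

(** The maximum makes the logarithm nonnegative on all matrices, as [integral_polar] requires; for T
    and U in the cone the trace is already nonnegative. *)
Let psi (T U : 'M[R]_d) : \bar R := (ln (1 + sigma * Num.max 0 (\tr (T *m U))))%:E.

Let mpsi T : measurable_fun setT (psi T).
Proof.
rewrite /psi; mfun; apply: measurable_maxr => //.
exact: (measurableT_comp (@measurable_mxtrace R d) (@measurable_mulmxl R d _)).
Qed.

Let psi0 T U : (0 <= psi T U)%E.
Proof.
rewrite lee_fin ln_ge0// lerDl mulr_ge0 ?(ltW sigma0)//.
by rewrite le_max lexx.
Qed.

Let beta_sphere U : S U -> beta_Sigma sigma%:M U = sigma^-1.
Proof.
by move=> [_ /= trU]; rewrite /beta_Sigma invmx_scalar mul_scalar_mx mxtraceZ trU mulr1.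
Qed.

(** |sigma I|^eta = sigma^(d eta) cancels (1 / sigma)^(eta d). *)
Let density_sphere U : S U -> density_Sigma eta sigma%:M U = 1.
Proof.
move=> SU; rewrite /density_Sigma beta_sphere// det_scalar.
rewrite -powR_mulrn ?(ltW sigma0)// -powRrM -(powR_inv1 (ltW sigma0)) -powRrM.
rewrite -powRD; last by rewrite (gt_eqF sigma0) implybT.
by rewrite (_ : _ + _ = 0) ?powRr0 ?invr1//; ring.
Qed.

Definition gamma_exponent (T : 'M[R]_d) : \bar R :=
  (\int[alpha_Sigma dU eta omega sigma%:M]_(U in trace_sphere d)
     \int[lebesgue_measure]_(r in `]0%R, +oo[)
        ((1 - expR (- (r * \tr (T *m U)))) *
         (expR (- (beta_Sigma sigma%:M U * r)) / r))%:E)%E.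

(** The factor Gamma (eta d) in [c_gamma] is the radial integral of [integral_polar], so that only
    omega / Gamma_d (eta) remains in front. *)
Lemma gamma_exponentE (T : 'M[R]_d) : nonneg_definite d T ->
  gamma_exponent T = ((omega%:num / mgamma_fun d eta)%:E *
    \int[lebesgue_sym d]_X ((mgamma_density p X)%:E * psi T ((\tr X)^-1 *: X)))%E.
Proof.
move=> nT; rewrite integral_polar//.
transitivity (\int[alpha_Sigma dU eta omega sigma%:M]_(U in S) psi T U)%E.
  apply: eq_integral => U; rewrite inE => SU; have [nU _] := SU.
  have tU := tr_mulmx_ge0 nT nU.
  rewrite /psi (max_idPr tU) beta_sphere// integral_frullani ?invr_gt0//.
  by rewrite invrK mulrC.
have mdU : measurable_fun setT (fun U : 'M[R]_d => (\det U `^ p)%:E * psi T U)%E.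
  by apply: emeasurable_funM; [mfun; exact: measurable_det|exact: mpsi].
have mpS : measurable_fun S (psi T) by apply: measurable_funTS; exact: mpsi.
rewrite /alpha_Sigma ge0_integral_mdensity//.
transitivity (\int[alpha_eta dU eta omega]_(U in S) psi T U)%E.
  by apply: eq_integral => U; rewrite inE => SU; rewrite density_sphere// mule1.
rewrite /alpha_eta ge0_integral_mdensity//.
have [g0 _] := mgamma_funP.
transitivity (\int[dU]_(U in S) ((c_gamma d eta omega)%:E * ((\det U `^ p)%:E * psi T U)))%E.
  by apply: eq_integral => U _; rewrite /density_eta EFinM muleC muleA.
rewrite ge0_integralZl//; last 3 first.
- exact: measurable_funTS.
- by move=> U _; rewrite mule_ge0// lee_fin powR_ge0.
- by rewrite lee_fin /c_gamma mulr_ge0 ?invr_ge0 ?(ltW g0)// mulr_ge0 ?gamma_fun_ge0.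
by rewrite muleA -EFinM /c_gamma; congr (_%:E * _)%E; ring.
Qed.

Lemma gamma_exponent_conj (O T : 'M[R]_d) : O *m O^T = 1%:M ->
  nonneg_definite d T -> gamma_exponent (O^T *m T *m O) = gamma_exponent T.
Proof.
move=> OO nT.
have nT' : nonneg_definite d (O^T *m T *m O).
  by have := nonneg_definite_congr O^T nT; rewrite trmxK.
rewrite !gamma_exponentE//; congr (_ * _)%E.
rewrite -[RHS](integral_lebesgue_sym_conj OO); last 2 first.
- apply: emeasurable_funM; first exact/measurable_EFinP.
  exact: (measurableT_comp (mpsi T) measurable_normalize).
- by move=> X; rewrite mule_ge0// lee_fin mgamma_density_ge0.
apply: eq_integral => X _; rewrite mgamma_density_conj//; congr (_ * _)%E.
rewrite /psi; congr (ln (1 + sigma * Num.max 0 _))%:E.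
rewrite (mxtrace_mulC (O *m X) O^T) mulmxA (mulmx1C OO) mul1mx.
rewrite -!scalemxAr !mxtraceZ; congr (_ * _).
by rewrite [in RHS]mulmxA [RHS]mxtrace_mulC !mulmxA.
Qed.

Lemma gamma_exponent_scalar (t : R) : 0 <= t ->
  gamma_exponent t%:M = (omega%:num * ln (1 + t * sigma))%:E.
Proof.
move=> t0; have [g0 gE] := mgamma_funP.
have nT : nonneg_definite d t%:M.
  split; first by rewrite tr_scalar_mx.
  by move=> v; rewrite mul_mx_scalar -scalemxAl mxE mulr_ge0// quad_ge0.
have l0 : 0 <= ln (1 + t * sigma) by rewrite ln_ge0// lerDl mulr_ge0// ltW.
rewrite gamma_exponentE//.
transitivity ((omega%:num / mgamma_fun d eta)%:E * \int[lebesgue_sym d]_X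
    ((ln (1 + t * sigma))%:E * (@mgamma_density R p d X)%:E))%E.
  congr (_ * _)%E; apply: eq_integral => X _; rewrite muleC.
  have [pX|nX] := pselect (PD X); last first.
    by rewrite /mgamma_density indicE memNset// mul0r !mule0.
  rewrite /psi mul_scalar_mx !mxtraceZ mulVf ?gt_eqF ?pos_definite_tr// mulr1.
  by rewrite (max_idPr t0) (mulrC sigma).
rewrite ge0_integralZl_EFin//; last 2 first.
- by move=> X _; rewrite lee_fin mgamma_density_ge0.
- exact/measurable_EFinP.
by rewrite gE -!EFinM; congr EFin; field; rewrite gt_eqF.
Qed.

End matrix_gamma_exponent.

(** * The Laplace transform of the one-dimensional Gamma law *)

Section gamma_law.
Context {R : realType} (a b : R).
Hypotheses (a0 : 0 < a) (b0 : 0 < b).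
Notation leb := (@lebesgue_measure R).

Lemma gamma_pdf_ge0 x : 0 <= gamma_pdf a b x.
Proof.
rewrite /gamma_pdf; case: ifP => // _.
by rewrite !mulr_ge0 ?expR_ge0 ?powR_ge0 ?invr_ge0 ?gamma_fun_ge0.
Qed.

Lemma gamma_pdfE x :
  gamma_pdf a b x = \1_`]0%R, +oo[ x * (b `^ a / gamma_fun a * x `^ (a - 1) * expR (- (b * x))).
Proof.
by rewrite /gamma_pdf indicE mem_setE in_itv/= andbT; case: ifP; rewrite ?mul1r ?mul0r.
Qed.

Lemma measurable_gamma_pdf : measurable_fun [set: R] (gamma_pdf a b).
Proof.
rewrite (funext gamma_pdfE); mfun.
exact: measurable_indic.
Qed.

(** The value (1 + t / b)^(-a) is written as an exponential, the form in which
    [gamma_exponent_scalar] enters the transform of the trace. *)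
Lemma laplace_gamma_pdf (t : R) : 0 <= t ->
  (\int[leb]_x ((expR (- (t * x)))%:E * (gamma_pdf a b x)%:E) =
   (expR (- (a * ln (1 + t / b))))%:E)%E.
Proof.
move=> t0; have bt : 0 < b + t by rewrite ltr_pwDl.
have c0 : 0 <= b `^ a / gamma_fun a by rewrite divr_ge0 ?powR_ge0 ?gamma_fun_ge0.
transitivity (\int[leb]_(x in `]0%R, +oo[) ((b `^ a / gamma_fun a)%:E *
    (x `^ (a - 1) * expR (- ((b + t) * x)))%:E))%E.
  rewrite [RHS]integral_mkcond; apply: eq_integral => x _.
  rewrite gamma_pdfE /patch indicE; case: ifPn => _; last by rewrite mul0r mule0.
  by rewrite -!EFinM mul1r mulrDl opprD expRD; congr EFin; ring.
rewrite ge0_integralZl_EFin//; last 2 first.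
- by move=> x _; rewrite lee_fin mulr_ge0 ?powR_ge0 ?expR_ge0.
- by apply: measurable_funTS; mfun.
rewrite integral_gamma_rate// -EFinM; congr EFin.
have g0 := gamma_fun_gt0 a0.
have -> : b `^ a / gamma_fun a * ((b + t) `^ (- a) * gamma_fun a) =
    b `^ a * (b + t) `^ (- a) by field; rewrite gt_eqF.
have -> : 1 + t / b = (b + t) / b by field; rewrite gt_eqF.
by rewrite ln_div ?posrE// /powR !gt_eqF// -expRD; congr expR; ring.
Qed.

End gamma_law.

(** * Invariance of the matrix law and the law of its trace *)

Section main.
Context {R : realType} (d : nat) (eta sigma : R) (omega : {posnum R}).
Variable dU : {measure set 'M[R]_d -> \bar R}.
Hypotheses (d0 : (1 <= d)%N) (etad : (d%:R - 1) / 2 < eta) (sigma0 : 0 < sigma).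
Hypothesis dUP : is_spherical_measure dU.
Implicit Types mu : probability 'M[R]_d R.

Lemma AGamma_orthogonally_invariant mu :
  is_AGamma dU eta omega sigma%:M mu -> orthogonally_invariant mu.
Proof.
move=> [_ mu1 muL] O OO A mA.
have mT := @measurable_mx_conj R d O.
pose T : {mfun 'M[R]_d >-> 'M[R]_d} := HB.pack (fun X : 'M[R]_d => O *m X *m O^T)
  (isMeasurableFun.Build _ _ _ _ (fun X : 'M[R]_d => O *m X *m O^T) mT).
pose nu : probability 'M[R]_d R := distribution mu T.
have Ou := unitmx_orthogonal OO.
have nu1 : nu (nonneg_definite d) = 1%E.
  rewrite -mu1 /nu /= /distribution /pushforward; congr (mu _).
  apply/seteqP; split => X /=; last exact: nonneg_definite_congr.
  move=> /(nonneg_definite_congr O^T); rewrite trmxK.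
  by rewrite !mulmxA (mulmx1C OO) mul1mx -mulmxA (mulmx1C OO) mulmx1.
apply/esym; apply: (laplace_matrix_inj mu1 nu1) mA => Th nTh.
have nTh' : nonneg_definite d (O^T *m Th *m O).
  by have := nonneg_definite_congr O^T nTh; rewrite trmxK.
have mE : measurable_fun setT (fun X : 'M[R]_d => (expR (- \tr (Th *m X)))%:E).
  by mfun; exact: (measurableT_comp (@measurable_mxtrace R d) (@measurable_mulmxl R d _)).
rewrite [RHS](ge0_integral_pushforward mT)//=.
rewrite preimage_setT muL// -/(gamma_exponent eta sigma omega dU Th).
rewrite -(gamma_exponent_conj omega d0 etad sigma0 dUP OO nTh).
rewrite /gamma_exponent -muL//; apply: eq_integral => X _ /=.
by rewrite -[in LHS]mulmxA -[in LHS]mulmxA mxtrace_mulC !mulmxA.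
Qed.

Lemma AGamma_tr mu : is_AGamma dU eta omega sigma%:M mu ->
  forall A : set R, measurable A ->
    pushforward mu (fun X : 'M[R]_d => \tr X) A = gamma_prob omega%:num sigma^-1 A.
Proof.
move=> [_ mu1 muL] A mA.
have muN : mu (~` nonneg_definite d) = 0%E.
  by rewrite probability_setC ?mu1 ?subee//; exact: measurable_nonneg_definite.
have b0 : 0 < sigma^-1 by rewrite invr_gt0.
have mt : measurable_fun setT ((fun X : 'M[R]_d => \tr X) : _ -> measurableTypeR R).
  exact: measurable_mxtrace.
pose m1 : {measure set (measurableTypeR R) -> \bar R} :=
  measure_function_pushforward__canonical__measure_function_Measure mu mt.
pose m2 : {measure set (measurableTypeR R) -> \bar R} :=
  mdensity (@lebesgue_measure R) (measurable_gamma_pdf omega%:num sigma^-1)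
    (gamma_pdf_ge0 omega%:num sigma^-1).
have me (t : R) : measurable_fun setT (fun x : measurableTypeR R => (expR (- (t * x)))%:E).
  by mfun.
have lap2 (t : R) : 0 <= t -> (\int[m2]_x (expR (- (t * x)))%:E =
    (expR (- (omega%:num * ln (1 + t * sigma))))%:E)%E.
  move=> t0; rewrite /m2 ge0_integral_mdensity//.
  by rewrite laplace_gamma_pdf// invrK.
apply: (@laplace_line_inj R m1 m2) => //.
- by rewrite /m1/= /pushforward preimage_setT probability_setT ltry.
(* The transform at 0 is the total mass, hence finite. *)
- have := lap2 0 (lexx _); under eq_integral do rewrite mul0r oppr0 expR0.
  by rewrite integral_cst// mul1e => ->; rewrite ltry.
- rewrite /m1/= /pushforward.
  apply: (@subset_measure0 _ _ _ mu _ (~` nonneg_definite d)).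
  + by rewrite -[X in measurable X]setTI; apply: (mt).
  + by apply: measurableC; exact: measurable_nonneg_definite.
  (* A negative trace is impossible on the cone, because tr X = tr (I X) >= 0. *)
  + move=> X /=; rewrite in_itv/= => tX nX; move: tX; apply/negP; rewrite -leNgt.
    rewrite -[X]mul1mx; apply: tr_mulmx_ge0 => //.
    by split=> [|v]; rewrite ?trmx1// mulmx1 quad_ge0.
  + exact: muN.
- rewrite /m2/= /mdensity integral0_eq// => x; rewrite /= in_itv/= => x0.
  by rewrite /gamma_pdf ltNge (ltW x0).
- move=> t t0; rewrite lap2// [LHS](ge0_integral_pushforward mt)//=.
  rewrite preimage_setT.
  have nT : nonneg_definite d t%:M.
    split; first by rewrite tr_scalar_mx.
    by move=> v; rewrite mul_mx_scalar -scalemxAl mxE mulr_ge0// quad_ge0.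
  transitivity (\int[mu]_X (expR (- \tr (t%:M *m X)))%:E)%E.
    by apply: eq_integral => X _ /=; rewrite mul_scalar_mx mxtraceZ.
  rewrite muL// -/(gamma_exponent eta sigma omega dU t%:M).
  by rewrite (gamma_exponent_scalar omega d0 etad sigma0 dUP t0).
Qed.

End main.

Theorem lemma5p8 (R : realType) (d : nat) (eta sigma : R) (omega : {posnum R})
    (dU : {measure set 'M[R]_d -> \bar R}) :
  (1 <= d)%N -> (d%:R - 1) / 2 < eta -> 0 < sigma ->
  is_spherical_measure dU ->
  (forall mu : probability 'M[R]_d R,
      is_AGamma dU eta omega sigma%:M mu -> orthogonally_invariant mu)
  /\
  (forall (disp : measure_display) (Omega : measurableType disp)
          (P : probability Omega R) (M : {RV P >-> 'M[R]_d}),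
      is_AGamma dU eta omega sigma%:M (distribution P M) ->
      forall A : set R, measurable A ->
        pushforward P (fun x => \tr (M x)) A
        = gamma_prob omega%:num sigma^-1 A).
Proof.
move=> d0 etad sigma0 dUP; split => [mu|disp Omega P M PM A mA].
  exact: AGamma_orthogonally_invariant.
exact: (AGamma_tr d0 etad sigma0 dUP PM mA).
Qed.
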